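(* Let a complex Banach space $X$, with norm $\|\cdot\|_X$, be a linear subspace of $L^1(\mathbb{T})$ such that $f(\cdot+a)\in X$ whenever $f\in X$ and $a\in\mathbb{T}$ and such that the function $x\mapsto e^{ikx}$ belongs to $X$ for every $k\in\mathbb{Z}$. Suppose that: (1) there exists a number $c>0$ such that $\|f\|_{L^1(\mathbb{T})}\leq c\,\|f\|_{X}$ for every $f\in X$; (2) $\|f(\cdot+a)-f(\cdot)\|_{X}\to0$ as $a\to0$ for every $f\in X$; (3) $\|e^{ikx}\|_{X}=O(|k|^\alpha)$ as $|k|\to\infty$ for a certain number $\alpha\geq0$. If a function $f\in X$ satisfies $$\sum_{|k|\geq n+1}|k|^{\alpha p}\,|\widehat{f}(k)|^p=O\left(\frac{1}{n^{p-1}}\right)\quad\text{as } n\to\infty$$ for a certain number $p\geq1$ (with the same $\alpha$ as in (3)), then the Fourier series of $f$ converges to $f$ in the Banach space $X$, i.e. $\|S_n(\cdot,f)-f\|_X\to0$ as $n\to\infty$.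
   Context: $\mathbb{T}$ is the additive quotient group $\mathbb{R}/2\pi\mathbb{Z}$; functions on $\mathbb{T}$ are identified with $2\pi$-periodic functions. $L^1(\mathbb{T})$ is the complex Banach space of complex-valued Lebesgue-integrable functions on $\mathbb{T}$ with norm $\|f\|_{L^1(\mathbb{T})}:=\frac{1}{2\pi}\int_{-\pi}^{\pi}|f(s)|\,ds$. For $f\in L^1(\mathbb{T})$, the Fourier coefficients are $\widehat{f}(k):=\frac{1}{2\pi}\int_{-\pi}^{\pi}f(s)e^{-iks}\,ds$, $k\in\mathbb{Z}$, and the symmetric partial sums of the Fourier series $\sum_{k\in\mathbb{Z}}\widehat{f}(k)e^{ikx}$ are $S_n(x,f):=\sum_{|k|\leq n}\widehat{f}(k)e^{ikx}$, $n\ge0$. Convergence of the Fourier series means convergence of these symmetric partial sums. *)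

(* Defs.v *)
From HB Require Import structures.
From mathcomp Require Import all_boot all_order all_algebra.
From mathcomp Require Import complex.
From mathcomp Require Import all_classical all_reals all_analysis.
From mathcomp Require Import measurable_realfun ring lra.

Set Implicit Arguments.
Unset Strict Implicit.
Unset Printing Implicit Defensive.

Import Order.TTheory GRing.Theory Num.Theory.
Import numFieldNormedType.Exports.

Local Open Scope classical_set_scope.
Local Open Scope ring_scope.
Local Open Scope complex_scope.

Section shift.
Context {R : realType}.
Local Notation mu := (@lebesgue_measure R).
Implicit Types (a : R) (h : R -> R) (A D : set R).

Definition shift_by a : measurableTypeR R -> measurableTypeR R := fun x => x + a.

Lemma measurable_shift_by a : measurable_fun [set: R] (shift_by a).
Proof. by apply: measurable_funD => //; exact: measurable_id. Qed.

HB.instance Definition _ a :=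
  isMeasurableFun.Build _ _ _ _ (shift_by a) (measurable_shift_by a).

Lemma measurable_shift_preimage a A :
  measurable A -> measurable (shift_by a @^-1` A).
Proof. by move=> mA; rewrite -[X in measurable X]setTI; exact: measurable_shift_by. Qed.

Lemma lebesgue_measure_shift a A : measurable A ->
  pushforward mu (shift_by a) A = mu A.
Proof.
move=> mA; apply/esym/lebesgue_measure_unique => //= _ [[x y]] _ <-.
rewrite /pushforward.
have -> : shift_by a @^-1` [set` `]x, y]] = [set` `](x - a), (y - a)]].
  by apply/seteqP; split => z /=; rewrite !in_itv/= /shift_by ltrBlDr lerBrDr.
rewrite /= !lebesgue_measure_itv/= !lte_fin ltrD2r.
by case: ifPn => // _; rewrite -!EFinB opprB addrA subrK.
Qed.

Lemma ae_shift a (P : R -> Prop) : {ae mu, forall x, P x} ->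
  {ae mu, forall x, P (x + a)}.
Proof.
move=> [N [mN N0 PN]]; exists (shift_by a @^-1` N); split.
- exact: measurable_shift_preimage.
- by rewrite -[LHS]/(pushforward mu (shift_by a) N) lebesgue_measure_shift.
- by move=> x /= Px; exact: PN.
Qed.

Lemma integrable_shift a h D : measurable D -> measurable_fun [set: R] h ->
  mu.-integrable D (EFin \o h) ->
  mu.-integrable (shift_by a @^-1` D) (EFin \o (h \o shift_by a)).
Proof.
move=> mD mh /integrableP[_ hoo]; have ms := measurable_shift_by a.
apply/integrableP; split.
  by apply/measurable_EFinP/measurable_funTS; exact: measurableT_comp.
rewrite -[X in (X < _)%E]/(\int[mu]_(x in shift_by a @^-1` D)
  ((fun y => `|(h y)%:E|%E) \o shift_by a) x)%E.
rewrite -ge0_integral_pushforward//; last first.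
  by apply/measurable_funTS; apply: measurableT_comp => //; exact/measurable_EFinP.
rewrite (@eq_measure_integral _ _ _ _ mu)// => A mA _.
exact: lebesgue_measure_shift.
Qed.

Lemma integrable_setU h A B : measurable A -> measurable B ->
  measurable_fun [set: R] h ->
  mu.-integrable A (EFin \o h) -> mu.-integrable B (EFin \o h) ->
  mu.-integrable (A `|` B) (EFin \o h).
Proof.
move=> mA mB mh iA iB; have mBA : measurable (B `\` A) by exact: measurableD.
have mah D : measurable_fun D (fun x => `|(h x)%:E|%E).
  by apply/measurable_funTS; apply: measurableT_comp => //; exact/measurable_EFinP.
apply/integrableP; split; first exact/measurable_EFinP/measurable_funTS.
have -> : A `|` B = A `|` (B `\` A).
  apply/seteqP; split => x /=; last by case=> [|[]]; [left|right].
  by case: (pselect (A x)); [left|move=> nAx [|]; [left|right]].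
rewrite ge0_integral_setU//; last by apply/disj_setPS => x /= [? []].
apply: lte_add_pinfty; first by case/integrableP: iA.
by case/integrableP: (integrableS mB mBA (@subDsetl _ _ _) iB).
exact: mah.
Qed.

Lemma integrable_periodic h : measurable_fun [set: R] h ->
  periodic h (pi *+ 2) -> mu.-integrable `[- pi, pi] (EFin \o h) ->
  forall a b : R, mu.-integrable `[a, b] (EFin \o h).
Proof.
move=> mh ph ih.
have pos : 0 < pi *+ 2 :> R by rewrite pmulrn_lgt0// pi_gt0.
have phN x : h (x - pi *+ 2) = h x by rewrite -[in RHS](subrK (pi *+ 2) x) ph.
have step n : mu.-integrable `[- (pi + pi *+ 2 *+ n), pi + pi *+ 2 *+ n] (EFin \o h).
  elim: n => [|n IH]; first by rewrite mulr0n addr0.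
  set c := pi + pi *+ 2 *+ n in IH *.
  have -> : pi + pi *+ 2 *+ n.+1 = c + pi *+ 2 by rewrite mulrSr addrA.
  have pc : pi <= c by rewrite lerDl mulrn_wge0// ltW.
  have I1 := @integrable_shift (pi *+ 2) h _ (measurable_itv _) mh IH.
  have I2 := @integrable_shift (- (pi *+ 2)) h _ (measurable_itv _) mh IH.
  have E1 : h \o shift_by (pi *+ 2) = h by apply/funext => x; exact: ph.
  have E2 : h \o shift_by (- (pi *+ 2)) = h by apply/funext => x; exact: phN.
  rewrite E1 in I1; rewrite E2 in I2.
  have mp x : measurable (shift_by x @^-1` [set` `[- c, c]]).
    exact: measurable_shift_preimage.
  have I12 := integrable_setU (mp _) (mp _) mh I1 I2.
  have mI := @measurable_itv R `[- c, c].
  have I3 := integrable_setU mI (measurableU _ _ (mp _) (mp _)) mh IH I12.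
  apply: integrableS I3 => //; first by do 2?apply: measurableU.
  move=> x /=; rewrite !in_itv/= /shift_by => /andP[x1 x2].
  have p0 := @pi_gt0 R; have [xc|xc] := leP x (- c); last have [xc'|xc'] := leP c x.
  - by right; left; apply/andP; split; lra.
  - by right; right; apply/andP; split; lra.
  - by left; apply/andP; split; lra.
move=> a b; pose M := Num.max `|a| `|b|.
have [n Mn] : exists n, M <= (pi *+ 2 : R) *+ n.
  exists (Num.Def.archi_bound (M / (pi *+ 2))).
  rewrite -[leRHS]mulr_natr mulrC -ler_pdivrMr// ltW// archi_boundP//.
  by apply: divr_ge0; [rewrite /M le_max normr_ge0|exact: ltW].
apply: integrableS (step n) => //.
move=> x /=; rewrite !in_itv/= => /andP[x1 x2].
move: Mn; rewrite /M ge_max !ler_norml => /andP[/andP[? _] /andP[_ ?]].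
by have := @pi_gt0 R => p0; apply/andP; split; lra.
Qed.

Lemma integrable_periodic_shift a h : measurable_fun [set: R] h ->
  periodic h (pi *+ 2) -> mu.-integrable `[- pi, pi] (EFin \o h) ->
  mu.-integrable `[- pi, pi] (EFin \o (fun x => h (x + a))).
Proof.
move=> mh ph ih.
have := integrable_shift a (measurable_itv `[- pi + a, pi + a])
   mh (integrable_periodic mh ph ih _ _).
suff -> : shift_by a @^-1` [set` `[- pi + a, pi + a]] = [set` `[- pi, pi]] by [].
by apply/seteqP; split => z /=; rewrite !in_itv/= /shift_by !lerD2r.
Qed.

End shift.

Section L1.
Variable R : realType.
Local Notation mu := (@lebesgue_measure R).
Local Notation C := R[i].

(* Borel representatives suffice: every Lebesgue measurable function agrees
   almost everywhere with a Borel measurable one. *)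
Definition L1_pred : {pred R -> C} := mem [set f : R -> C |
  [/\ periodic f (pi *+ 2),
      measurable_fun [set: R] (fun x => complex.Re (f x)),
      measurable_fun [set: R] (fun x => complex.Im (f x)),
      mu.-integrable `[- pi, pi] (fun x => (complex.Re (f x))%:E) &
      mu.-integrable `[- pi, pi] (fun x => (complex.Im (f x))%:E)]].

Lemma L1_predP (f : R -> C) : f \in L1_pred <->
  [/\ periodic f (pi *+ 2),
      measurable_fun [set: R] (fun x => complex.Re (f x)),
      measurable_fun [set: R] (fun x => complex.Im (f x)),
      mu.-integrable `[- pi, pi] (fun x => (complex.Re (f x))%:E) &
      mu.-integrable `[- pi, pi] (fun x => (complex.Im (f x))%:E)].
Proof. by rewrite inE. Qed.

Lemma L1_submod_closed : submod_closed L1_pred.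
Proof.
split.
  apply/L1_predP; split => //=; try exact: measurable_cst; exact: integrable0.
move=> [a b] f g /L1_predP[pf mf1 mf2 if1 if2] /L1_predP[pg mg1 mg2 ig1 ig2].
have E x : ((a +i* b) *: f + g) x = (a +i* b) * f x + g x by [].
have Re_ x : complex.Re (((a +i* b) *: f + g) x) =
    (a * complex.Re (f x) + (- b) * complex.Im (f x)) + complex.Re (g x).
  by rewrite E; case: (f x) => u v; case: (g x) => s t /=; rewrite mulNr.
have Im_ x : complex.Im (((a +i* b) *: f + g) x) =
    (a * complex.Im (f x) + b * complex.Re (f x)) + complex.Im (g x).
  by rewrite E; case: (f x) => u v; case: (g x) => s t /=.
have intlin c d u v w : mu.-integrable `[- pi, pi] (EFin \o u) ->
    mu.-integrable `[- pi, pi] (EFin \o v) ->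
    mu.-integrable `[- pi, pi] (EFin \o w) ->
    mu.-integrable `[- pi, pi] (fun x => (c * u x + d * v x + w x)%:E).
  move=> iu iv iw; have mI := @measurable_itv R `[- pi, pi].
  apply: (@eq_integrable _ _ _ mu _ mI
    ((fun x => c%:E * (EFin \o u) x) \+ (fun x => d%:E * (EFin \o v) x) \+ (EFin \o w))%E).
    by move=> x _ /=; rewrite -!EFinM -!EFinD.
  by apply: integrableD => //; apply: integrableD => //; exact: integrableZl.
apply/L1_predP; split.
- by move=> x; rewrite !E pf pg.
- apply: (eq_measurable_fun _ (fun x _ => esym (Re_ x))).
  by do !apply: measurable_funD; do ?apply: measurable_funM.
- apply: (eq_measurable_fun _ (fun x _ => esym (Im_ x))).
  by do !apply: measurable_funD; do ?apply: measurable_funM.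
- by apply: eq_integrable (intlin _ _ _ _ _ if1 if2 ig1) => // x _; rewrite Re_.
- by apply: eq_integrable (intlin _ _ _ _ _ if2 if1 ig2) => // x _; rewrite Im_.
Qed.

HB.instance Definition _ := GRing.isSubmodClosed.Build C (R -> C) L1_pred L1_submod_closed.

Record L1fun := MkL1fun { L1val :> R -> C ; L1valP : L1val \in L1_pred }.
HB.instance Definition _ := [isSub for L1val].
HB.instance Definition _ := [Choice of L1fun by <:].
HB.instance Definition _ := [SubChoice_isSubLmodule of L1fun by <:].

Definition null_pred : {pred L1fun} :=
  mem [set f : L1fun | {ae mu, forall x, f x = 0}].

Lemma null_predP (f : L1fun) : f \in null_pred <-> {ae mu, forall x, f x = 0}.
Proof. by rewrite inE. Qed.

Lemma null_submod_closed : submod_closed null_pred.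
Proof.
split; first by apply/null_predP; apply: aeW.
move=> a f g /null_predP f0 /null_predP g0; apply/null_predP.
apply: (@filterS2 _ _ (ae_filter_ringOfSetsType mu) _ _ _ _ f0 g0) => x fx gx.
by rewrite -[LHS]/(a * f x + g x) fx gx mulr0 addr0.
Qed.

HB.instance Definition _ := GRing.isSubmodClosed.Build C L1fun null_pred null_submod_closed.

(* For periodic functions, equality almost everywhere on R and on [-pi, pi]
   are the same. *)
Definition L1T : Type := Quotient.quot null_pred.
HB.instance Definition _ := GRing.Zmodule.on L1T.
HB.instance Definition _ := EqQuotient.on L1T.

Local Open Scope quotient_scope.

Lemma L1T_eqP (f g : L1fun) :
  \pi_L1T f = \pi_L1T g <-> {ae mu, forall x, f x = g x}.
Proof.
split.
- move=> /eqP; rewrite -(Quotient.idealrBE null_pred) => /null_predP.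
  by apply: (@filterS _ _ (ae_filter_ringOfSetsType mu)) => x /= /eqP; rewrite subr_eq0 => /eqP.
- move=> fg; apply/eqP; rewrite -(Quotient.idealrBE null_pred); apply/null_predP.
  apply: (@filterS _ _ (ae_filter_ringOfSetsType mu) _ _ _ fg) => x fgx.
  by rewrite -[LHS]/(f x - g x) fgx subrr.
Qed.

Lemma L1T_repr (f : L1fun) : {ae mu, forall x, repr (\pi_L1T f) x = f x}.
Proof. by apply/L1T_eqP; rewrite reprK. Qed.

Lemma L1T_piD (f g : L1fun) : \pi_L1T (f + g) = \pi_L1T f + \pi_L1T g.
Proof. by rewrite (Quotient.pi_add null_pred). Qed.

Definition L1T_scale (a : C) (u : L1T) : L1T := \pi_L1T (a *: repr u).

Lemma L1T_piZ a (f : L1fun) : \pi_L1T (a *: f) = L1T_scale a (\pi_L1T f).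
Proof.
apply/L1T_eqP; apply: (@filterS _ _ (ae_filter_ringOfSetsType mu) _ _ _ (L1T_repr f)) => x fx.
by rewrite -[LHS]/(a * f x) -[RHS]/(a * repr (\pi_L1T f) x) fx.
Qed.

Let L1T_scaleA a b u : L1T_scale a (L1T_scale b u) = L1T_scale (a * b) u.
Proof. by rewrite -{1}(reprK u) -[X in L1T_scale a X]L1T_piZ -L1T_piZ scalerA. Qed.
Let L1T_scale1 : left_id 1 L1T_scale.
Proof. by move=> u; rewrite -[u]reprK -!L1T_piZ scale1r. Qed.
Let L1T_scaleDr : right_distributive L1T_scale +%R.
Proof.
by move=> a u v; rewrite -[u]reprK -[v]reprK -L1T_piD -!L1T_piZ -L1T_piD scalerDr.
Qed.
Let L1T_scaleDl u : {morph L1T_scale^~ u : a b / a + b}.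
Proof. by move=> a b; rewrite -[u]reprK -!L1T_piZ -L1T_piD scalerDl. Qed.

HB.instance Definition _ := GRing.Zmodule_isLmodule.Build C L1T
  L1T_scaleA L1T_scale1 L1T_scaleDr L1T_scaleDl.

Definition normL1 (u : L1T) : R :=
  (pi *+ 2)^-1 * \int[mu]_(x in `[- pi, pi]) Normc.normc (repr u x).

Definition cintegral (D : set R) (f : R -> C) : C :=
  (\int[mu]_(x in D) complex.Re (f x)) +i* (\int[mu]_(x in D) complex.Im (f x)).

Definition cexpi (t : R) : C := cos t +i* sin t.

Definition fourier_coef (u : L1T) (k : int) : C :=
  ((pi *+ 2)^-1)%:C * cintegral `[- pi, pi] (fun x => repr u x * cexpi (- (k%:~R * x))).

Lemma translate_subproof (a : R) (f : L1fun) : (fun x => f (x + a)) \in L1_pred.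
Proof.
have /L1_predP[pf mf1 mf2 if1 if2] := L1valP f.
have P1 : periodic (fun x => complex.Re (f x)) (pi *+ 2) by move=> x /=; rewrite pf.
have P2 : periodic (fun x => complex.Im (f x)) (pi *+ 2) by move=> x /=; rewrite pf.
apply/L1_predP; split.
- by move=> x; rewrite addrAC pf.
- by apply: (measurableT_comp mf1); exact: measurable_shift_by.
- by apply: (measurableT_comp mf2); exact: measurable_shift_by.
- exact: (integrable_periodic_shift a mf1 P1 if1).
- exact: (integrable_periodic_shift a mf2 P2 if2).
Qed.

Definition translate (a : R) (u : L1T) : L1T :=
  \pi_L1T (MkL1fun (translate_subproof a (repr u))).

Lemma translate_pi a (f : L1fun) :
  translate a (\pi_L1T f) = \pi_L1T (MkL1fun (translate_subproof a f)).
Proof. by apply/L1T_eqP; exact: ae_shift (L1T_repr f). Qed.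

Lemma cexpi_subproof (k : int) : (fun x => cexpi (k%:~R * x)) \in L1_pred.
Proof.
have per (h : R -> R) : periodic h (pi *+ 2) -> periodic (fun x => h (k%:~R * x)) (pi *+ 2).
  move=> ph x; rewrite mulrDr [X in _ + X]mulrzl; case: k => n.
    by rewrite -pmulrn (periodicn ph).
  rewrite NegzE mulrNz -pmulrn.
  by rewrite -[LHS](periodicn ph n.+1) subrK.
have cont (h : R -> R) : continuous h ->
    measurable_fun [set: R] (fun x : R => h (k%:~R * x)) /\
    mu.-integrable `[- pi, pi] (fun x : R => (h (k%:~R * x))%:E).
  move=> ch; have chk : continuous (fun x : R => h (k%:~R * x)).
    by move=> x; apply: continuous_comp; [exact: mulrl_continuous|exact: ch].
  split; first exact: continuous_measurable_fun.
  apply: (@continuous_compact_integrable _ (fun x : R => h (k%:~R * x))).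
    exact: segment_compact.
  exact: continuous_subspaceT.
have [mc ic] := cont _ (@continuous_cos R); have [ms is_] := cont _ (@continuous_sin R).
apply/L1_predP; split => // x.
by rewrite /cexpi (per _ (@cosD2pi R)) (per _ (@sinD2pi R)).
Qed.

Lemma Rintegral_ae (g h : R -> R) : measurable_fun [set: R] g ->
  measurable_fun [set: R] h -> {ae mu, forall x, g x = h x} ->
  \int[mu]_(x in `[- pi, pi]) g x = \int[mu]_(x in `[- pi, pi]) h x.
Proof.
move=> mg mh gh; rewrite /Rintegral; congr fine; apply: ae_eq_integral => //.
- exact/measurable_EFinP/measurable_funTS.
- exact/measurable_EFinP/measurable_funTS.
- by apply: (@filterS _ _ (ae_filter_ringOfSetsType mu) _ _ _ gh) => x /= ->.
Qed.

Lemma normL1_pi (f : L1fun) : normL1 (\pi_L1T f) =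
  (pi *+ 2)^-1 * \int[mu]_(x in `[- pi, pi]) Normc.normc (f x).
Proof.
have mn (g : L1fun) : measurable_fun [set: R] (fun x => Normc.normc (g x)).
  have /L1_predP[_ mg1 mg2 _ _] := L1valP g.
  apply: (eq_measurable_fun (fun x =>
    Num.sqrt (complex.Re (g x) ^+ 2 + complex.Im (g x) ^+ 2))).
    by move=> x _; case: (g x).
  apply: (measurableT_comp (continuous_measurable_fun (@sqrt_continuous R))).
  by apply: measurable_funD; exact: measurable_funX.
congr (_ * _); apply: Rintegral_ae => //.
by apply: (@filterS _ _ (ae_filter_ringOfSetsType mu) _ _ _ (L1T_repr f)) => x /= ->.
Qed.

Lemma fourier_coef_pi (f : L1fun) k : fourier_coef (\pi_L1T f) k =
  ((pi *+ 2)^-1)%:C *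
    cintegral `[- pi, pi] (fun x => f x * cexpi (- (k%:~R * x))).
Proof.
have mcs (h : R -> R) : continuous h ->
    measurable_fun [set: R] (fun x : R => h (- (k%:~R * x))).
  move=> ch; apply: (measurableT_comp (continuous_measurable_fun ch)).
  apply: continuous_measurable_fun => x; apply: continuousN.
  exact: mulrl_continuous.
have mc := mcs _ (@continuous_cos R); have ms := mcs _ (@continuous_sin R).
have mRe (g : L1fun) : measurable_fun [set: R]
    (fun x => complex.Re (g x * cexpi (- (k%:~R * x)))).
  have /L1_predP[_ mg1 mg2 _ _] := L1valP g.
  apply: (eq_measurable_fun (fun x => complex.Re (g x) * cos (- (k%:~R * x))
    - complex.Im (g x) * sin (- (k%:~R * x)))).
    by move=> x _; case: (g x).
  by apply: measurable_funB; exact: measurable_funM.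
have mIm (g : L1fun) : measurable_fun [set: R]
    (fun x => complex.Im (g x * cexpi (- (k%:~R * x)))).
  have /L1_predP[_ mg1 mg2 _ _] := L1valP g.
  apply: (eq_measurable_fun (fun x => complex.Re (g x) * sin (- (k%:~R * x))
    + complex.Im (g x) * cos (- (k%:~R * x)))).
    by move=> x _; case: (g x).
  by apply: measurable_funD; exact: measurable_funM.
by congr (_ * (_ +i* _)); apply: Rintegral_ae => //;
  apply: (@filterS _ _ (ae_filter_ringOfSetsType mu) _ _ _ (L1T_repr f)) => x /= ->.
Qed.

Definition expL1 (k : int) : L1T := \pi_L1T (MkL1fun (cexpi_subproof k)).

(* \sum_(|k| <= n) c k *: e k, the index being k = i - n *)
Definition symmetric_sum (V : lmodType C) (c : int -> C) (e : int -> V)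
    (n : nat) : V :=
  \sum_(i < n.*2.+1) c (i%:Z - n%:Z) *: e (i%:Z - n%:Z).

End L1.

(* Main.v *)
(* Let phi t = tau t f, a continuous 2 pi-periodic map from R to X. The Riemann
   sums of t |-> e^(-imt) phi t converge in X. By (1) they also converge in
   L^1, where Fubini's theorem identifies the limit, so that in X the limit is
   the m-th term of the Fourier series of f. Averaging phi against the Fejer
   kernel then shows that the Cesaro means of the Fourier series converge to f
   in X. Hypothesis (3) and the decay of the coefficients bound
   ||S_(n+j) f - S_n f|| by a small constant whenever j <= n / q with q large,
   and a Tauberian argument passes from Cesaro convergence to convergence. *)

Require Import Defs.
From mathcomp Require Import all_boot all_order all_algebra.
From mathcomp Require Import complex.
From mathcomp Require Import all_classical all_reals all_analysis.
From mathcomp Require Import measurable_realfun ring lra zify.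

Set Implicit Arguments.
Unset Strict Implicit.
Unset Printing Implicit Defensive.

Import Order.TTheory GRing.Theory Num.Theory.
Import numFieldNormedType.Exports.

Local Open Scope classical_set_scope.
Local Open Scope ring_scope.
Local Open Scope complex_scope.

(** * Integrals of periodic functions *)

Section periodic_integral.
Context {R : realType}.
Local Notation mu := (@lebesgue_measure R).

(** The limit of the Riemann sums exists by completeness alone, and its image in L^1 is a class of
    functions without values at points. What identifies it is uniformity: one mesh size serves all
    offsets [s] of the grid, and averaging over [s] turns a Riemann sum of translates into an exact
    integral. The Fejer kernel is also handled on grids: once a grid has more points than the
    degree, the exponentials are exactly orthogonal on it, and the kernel identities become finite
    algebra. The norm of X is not assumed translation invariant; bounds on translates come from the
    compactness of one period. The decay hypothesis changes its nature at p = 1, where it merely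
    bounds the series and smallness comes from the tails. For p > 1 smallness of a block comes from
    its length being a small fraction of n. *)

Lemma periodicz (V : zmodType) (f : R -> V) (T : R) (k : int) (x : R) :
  periodic f T -> f (x + T *~ k) = f x.
Proof.
move=> pf; case: k => n; first by rewrite -pmulrn periodicn.
by rewrite NegzE mulrNz -pmulrn -[LHS](periodicn pf n.+1) subrK.
Qed.

Lemma periodic_reduction (T : R) (x c : R) : 0 < T ->
  exists k : int, c <= x + T *~ k < c + T.
Proof.
move=> T0; pose k : int := Num.floor ((x - c) / T); exists (- k).
have /andP[k1 k2] := floor_itv ((x - c) / T).
rewrite -/k in k1 k2; rewrite -mulrzl mulrNz mulNr.
move: k1 k2; rewrite ler_pdivlMr// ltr_pdivrMr// intrD => k1 k2.
by apply/andP; split; lra.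
Qed.

Variable q : R -> R.
Hypotheses (mq : measurable_fun [set: R] q) (pq : periodic q (pi *+ 2))
  (iq : mu.-integrable `[- pi, pi] (EFin \o q)).

Lemma Rintegral_shift (a c d : R) :
  \int[mu]_(x in `[c, d]) q (x + a) = \int[mu]_(x in `[c + a, d + a]) q x.
Proof.
have E : shift_by a @^-1` [set` `[c + a, d + a]] = [set` `[c, d]].
  by apply/seteqP; split => z /=; rewrite !in_itv/= /shift_by !lerD2r.
rewrite /Rintegral; congr fine; rewrite -E; set D := [set` `[c + a, d + a]].
rewrite -[LHS]/(\int[mu]_(x in shift_by a @^-1` D) ((EFin \o q) \o shift_by a) x)%E.
have <- := @integral_pushforward _ _ (measurableTypeR R) (measurableTypeR R) R (shift_by a)
  (measurable_shift_by a) mu D (EFin \o q).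
- by apply: eq_measure_integral => A mA _; exact: lebesgue_measure_shift.
- exact/measurable_EFinP.
- exact: (integrable_shift a (measurable_itv _) mq (integrable_periodic mq pq iq _ _)).
- exact: measurable_itv.
Qed.

Lemma Rintegral_cat (a b c : R) : a <= b <= c ->
  \int[mu]_(x in `[a, c]) q x =
  \int[mu]_(x in `[a, b]) q x + \int[mu]_(x in `[b, c]) q x.
Proof.
move=> /andP[ab bc].
rewrite -(Rintegral_itv_obnd_cbnd (r := b)); last first.
  apply: integrableS (integrable_periodic mq pq iq b c) => //.
  by apply: subset_itvr; rewrite bnd_simp.
rewrite -(@Rintegral_itvB _ _ (BLeft a) (BRight c) b) ?subrKC//.
exact: integrable_periodic.
Qed.

(** Modulo the period the shift is some b in [0, 2 pi). The window [- pi + b, pi + b] then overhangs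
    at pi by [pi, pi + b], a translate by one period of the lost piece [- pi, - pi + b]. *)
Lemma Rintegral_periodic_shift (a : R) :
  \int[mu]_(x in `[- pi, pi]) q (x + a) = \int[mu]_(x in `[- pi, pi]) q x.
Proof.
have p0 := @pi_gt0 R.
have [|k /andP[k0 k1]] := @periodic_reduction (pi *+ 2) a 0; first by rewrite pmulrn_lgt0.
under eq_Rintegral do rewrite -(periodicz k _ pq) -addrA.
move: (a + _) k0 k1 => b b0; rewrite add0r => b1.
rewrite Rintegral_shift (@Rintegral_cat (- pi + b) pi); last by apply/andP; split; lra.
rewrite (@Rintegral_cat (- pi) (- pi + b) pi); last by apply/andP; split; lra.
rewrite addrC; congr (_ + _).
rewrite [in LHS](_ : pi = - pi + pi *+ 2); last by rewrite mulr2n addrA addNr add0r.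
rewrite addrAC -Rintegral_shift; apply: eq_Rintegral => x _.
exact: pq.
Qed.

End periodic_integral.

Section mean_deviation.
Context {R : realType}.
Local Notation mu := (@lebesgue_measure R).
Local Notation I := `[- pi, pi]%classic.

Lemma EFin_Rintegral (h : R -> R) : mu.-integrable I (EFin \o h) ->
  (\int[mu]_(x in I) h x)%:E = (\int[mu]_(x in I) (h x)%:E)%E.
Proof. by move=> ih; rewrite /Rintegral fineK//; exact: integrable_fin_num. Qed.

Lemma integrable_cst_period (c : R) : mu.-integrable I (EFin \o cst c).
Proof.
apply: continuous_compact_integrable; first exact: segment_compact.
by apply: continuous_subspaceT => x; exact: cvg_cst.
Qed.

Lemma fine_mu_period : fine (mu I) = pi *+ 2.
Proof.
by rewrite lebesgue_measure_itv/= lte_fin gtrN ?pi_gt0//= opprK mulr2n.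
Qed.

Variables (g q : R -> R) (eps : R).
Hypotheses (mg : measurable_fun [set: R] g)
  (ig : mu.-integrable I (EFin \o g))
  (mq : measurable_fun [set: R] q) (pq : periodic q (pi *+ 2))
  (iq : mu.-integrable I (EFin \o q)).

Let dev (s x : R) : R := `|g x - q (x + s)|.
Let qbar : R := (pi *+ 2)^-1 * \int[mu]_(x in I) q x.

Let idev_s s : mu.-integrable I (EFin \o dev s).
Proof.
suff ih : mu.-integrable I (EFin \o (fun x => g x - q (x + s))).
  exact: (integrable_norm ih).
rewrite [X in integrable _ _ X](_ : _ = ((EFin \o g) \- (EFin \o (fun x => q (x + s)%R)))%E)//.
by apply: integrableB => //; exact: integrable_periodic_shift.
Qed.

Let idiff x : mu.-integrable I (EFin \o (fun s => g x - q (x + s))).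
Proof.
rewrite [X in integrable _ _ X](_ : _ =
  ((EFin \o cst (g x)) \- (EFin \o (fun s => q (s + x)%R)))%E); last first.
  by apply/funext => s /=; rewrite (addrC s).
apply: integrableB => //; first exact: integrable_cst_period.
exact: integrable_periodic_shift.
Qed.

Let idev_x x : mu.-integrable I (EFin \o dev^~ x).
Proof. exact: (integrable_norm (idiff x)). Qed.

Let pointwise x : (pi *+ 2) * `|g x - qbar| <= \int[mu]_(s in I) dev s x.
Proof.
apply: le_trans (le_normr_Rintegral _ (idiff x)) => //.
rewrite RintegralB//; last 2 first.
- exact: (integrable_cst_period (g x)).
- rewrite [X in integrable _ _ X](_ : _ = (EFin \o (fun s => q (s + x)))).
    exact: integrable_periodic_shift.
  by apply/funext => s /=; rewrite addrC.
rewrite Rintegral_cst// fine_mu_period.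
under [X in _ * _ - X]eq_Rintegral do rewrite addrC.
rewrite Rintegral_periodic_shift//.
have p0 : 0 < pi *+ 2 :> R by rewrite pmulrn_lgt0// pi_gt0.
rewrite -{1}(gtr0_norm p0) -normrM /qbar mulrBr mulrA divff ?gt_eqF// mul1r.
by rewrite mulrC.
Qed.

(** The indicators cut out the square [I] x [I], so that Tonelli's theorem can be applied on the
    whole plane. *)
Let F (z : measurableTypeR R * measurableTypeR R) : \bar R :=
  (dev z.2 z.1 * \1_I z.1 * \1_I z.2)%:E.

Let mF : measurable_fun setT F.
Proof.
apply/measurable_EFinP; apply: measurable_funM; last first.
  by apply: measurableT_comp (measurable_snd) => //; exact: measurable_indic.
apply: measurable_funM; last first.
  by apply: measurableT_comp (measurable_fst) => //; exact: measurable_indic.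
apply: measurableT_comp => //; apply: measurable_funB.
  exact: measurableT_comp mg measurable_fst.
apply: measurableT_comp mq _; apply: measurable_funD; [exact: measurable_fst|exact: measurable_snd].
Qed.

Let F0 z : (0 <= F z)%E.
Proof. by rewrite lee_fin !mulr_ge0// /dev. Qed.

Let intF2 x : (\int[mu]_s F (x, s) =
  ((fun x => (\int[mu]_(s in I) dev s x)%:E) \_ I) x)%E.
Proof.
rewrite patchE; case: ifPn => xI; last first.
  rewrite integral0_eq// => s _; rewrite /F /= ?indicE (negbTE xI).
  by rewrite mulr0 mul0r.
rewrite EFin_Rintegral// [RHS]integral_mkcond; apply: eq_integral => s _.
rewrite patchE /F /= ?indicE xI mulr1.
by case: ifPn; rewrite ?mulr1 ?mulr0.
Qed.

Let intF1 s : (\int[mu]_x F (x, s) =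
  ((fun s => (\int[mu]_(x in I) dev s x)%:E) \_ I) s)%E.
Proof.
rewrite patchE; case: ifPn => sI; last first.
  rewrite integral0_eq// => x _; rewrite /F /= ?indicE (negbTE sI).
  by rewrite mulr0.
rewrite EFin_Rintegral// [RHS]integral_mkcond; apply: eq_integral => x _.
rewrite patchE /F /= ?indicE sI mulr1.
by case: ifPn; rewrite ?mulr1 ?mulr0.
Qed.

(* Since q is periodic, [g x - mean q] is the mean over s of [g x - q (x + s)];
   exchange the two integrals. *)
Lemma mean_deviation :
  (forall s, \int[mu]_(x in I) `|g x - q (x + s)| <= eps) ->
  \int[mu]_(x in I) `|g x - (pi *+ 2)^-1 * \int[mu]_(x in I) q x| <= eps.
Proof.
move=> H; rewrite -/qbar.
have p0 : 0 < pi *+ 2 :> R by rewrite pmulrn_lgt0// pi_gt0.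
have iB : mu.-integrable I (EFin \o (fun x => `|g x - qbar|)).
  suff ih : mu.-integrable I (EFin \o (fun x => g x - qbar)).
    exact: (integrable_norm ih).
  rewrite [X in integrable _ _ X](_ : _ = ((EFin \o g) \- (EFin \o cst qbar))%E)//.
  by apply: integrableB => //; exact: integrable_cst_period.
rewrite -(ler_pM2l p0) -RintegralZl// -lee_fin EFin_Rintegral; last first.
  rewrite [X in integrable _ _ X](_ : _ = (fun x => (pi *+ 2)%:E *
    (EFin \o (fun x => `|g x - qbar|)%R) x)%E)//.
  exact: integrableZl.
apply: (@le_trans _ _ (\int[mu]_x \int[mu]_s F (x, s))%E).
  under [X in (_ <= X)%E]eq_integral do rewrite intF2.
  rewrite -integral_mkcond; apply: ge0_le_integral => //.
  - by move=> x _; rewrite lee_fin mulr_ge0// ltW.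
  - apply/measurable_EFinP; apply: measurable_funM => //.
    apply: measurableT_comp => //; apply: measurable_funB => //.
    exact: measurable_funTS.
  - rewrite -[X in measurable_fun X](setTI I); apply/measurable_restrict => //.
    have <- : (fun x => \int[mu]_s F (x, s))%E = (fun x => (\int[mu]_(s in I) dev s x)%:E) \_ I.
      by apply/funext => x; rewrite intF2.
    exact: (measurable_fun_fubini_tonelli_F F mF F0).
  - by move=> x _; rewrite lee_fin.
have -> := fubini_tonelli F mF F0.
under eq_integral do rewrite intF1.
rewrite -integral_mkcond.
apply: (@le_trans _ _ (\int[mu]_(s in I) (cst eps s)%:E)%E); last first.
  rewrite -EFin_Rintegral; last exact: integrable_cst_period.
  by rewrite Rintegral_cst// fine_mu_period lee_fin mulrC.
apply: ge0_le_integral => //.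
- move=> s _; rewrite lee_fin; apply: Rintegral_ge0 => x _; exact: normr_ge0.
- rewrite -[X in measurable_fun X](setTI I); apply/measurable_restrict => //.
  have <- : (fun s => \int[mu]_x F (x, s))%E = (fun s => (\int[mu]_(x in I) dev s x)%:E) \_ I.
    by apply/funext => s; rewrite intF1.
  exact: (measurable_fun_fubini_tonelli_G F mF F0).
- exact: (measurable_cst (eps%:E)).
- by move=> s _; rewrite lee_fin; exact: H.
Qed.

End mean_deviation.

Section real_periodic.
Context {R : realType}.
Local Notation mu := (@lebesgue_measure R).
Local Notation I := `[- pi, pi]%classic.

(** [h] vanishes almost everywhere on one period, and countably many translates of that period cover
    the line. The integers are enumerated by pairs n, - n to take a countable intersection over
    [nat]. *)
Lemma periodic_integral_norm_eq0 (h : R -> R) : measurable_fun [set: R] h ->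
  periodic h (pi *+ 2) -> mu.-integrable I (EFin \o h) ->
  \int[mu]_(x in I) `|h x| = 0 -> {ae mu, forall x, h x = 0}.
Proof.
move=> mh ph ih h0.
have p0 : 0 < pi *+ 2 :> R by rewrite pmulrn_lgt0// pi_gt0.
have aeI : {ae mu, forall x, I x -> h x = 0}.
  have : ae_eq mu I (EFin \o h) (cst 0%E).
    apply/ae_eq_integral_abs => //; first exact/measurable_EFinP/measurable_funTS.
    rewrite -[RHS]/(0%:E) -h0 EFin_Rintegral//; exact: (integrable_norm ih).
  by apply: (@filterS _ _ (ae_filter_ringOfSetsType mu)) => x /= H Ix; case: (H Ix).
have aeIk (k : int) : {ae mu, forall x, I (x + (pi *+ 2) *~ k) -> h x = 0}.
  apply: (@filterS _ _ (ae_filter_ringOfSetsType mu) _ _ _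
    (ae_shift ((pi *+ 2) *~ k) aeI)) => x /= H /H.
  by rewrite (periodicz k x ph).
have aeN (n : nat) : {ae mu, forall x,
    (I (x + (pi *+ 2) *~ n%:Z) -> h x = 0) /\ (I (x + (pi *+ 2) *~ (- n%:Z)) -> h x = 0)}.
  by apply: (@filterS2 _ _ (ae_filter_ringOfSetsType mu) _ _ _ _
    (aeIk n) (aeIk (- n%:Z))) => x.
have := ae_foralln aeN.
apply: (@filterS _ _ (ae_filter_ringOfSetsType mu)) => x /= H.
have [k /andP[k1 k2]] := periodic_reduction x (- pi) p0.
have Ik : I (x + (pi *+ 2) *~ k) by rewrite /= in_itv/=; apply/andP; split; lra.
case: k Ik {k1 k2} => n; first by case: (H n) => + _; exact.
by case: (H n.+1) => _; rewrite NegzE; exact.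
Qed.

(** The nodes [t] are arbitrary: the integral of the average equals that of [h] by translation
    invariance, whatever the nodes. *)
Definition shift_avg (h : R -> R) (t : nat -> R) (M : nat) (x : R) : R :=
  M%:R^-1 * \sum_(j < M) h (x + t j).

Variable h : R -> R.
Hypotheses (mh : measurable_fun [set: R] h) (ph : periodic h (pi *+ 2))
  (ih : mu.-integrable I (EFin \o h)).

Lemma measurable_shift_avg t M : measurable_fun [set: R] (shift_avg h t M).
Proof.
apply: measurable_funM => //; apply: measurable_sum => j.
exact: (measurableT_comp mh (measurable_shift_by _)).
Qed.

Lemma periodic_shift_avg t M : periodic (shift_avg h t M) (pi *+ 2).
Proof.
by move=> x; congr (_ * _); apply: eq_bigr => j _; rewrite addrAC ph.
Qed.

Let integrable_shift_sum (t : nat -> R) M : mu.-integrable I (EFin \o (fun x => \sum_(j < M) h (x + t j))).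
Proof.
elim: M => [|M IH].
  rewrite [X in integrable _ _ X](_ : _ = EFin \o cst 0).
    exact: (integrable_cst_period 0).
  by apply/funext => x /=; rewrite big_ord0.
rewrite [X in integrable _ _ X](_ : _ = ((EFin \o (fun x => \sum_(j < M) h (x + t j))%R) \+
    (EFin \o (fun x => h (x + t M))%R))%E).
  by apply: integrableD => //; exact: integrable_periodic_shift.
by apply/funext => x /=; rewrite big_ord_recr.
Qed.

Lemma integrable_shift_avg t M : mu.-integrable I (EFin \o shift_avg h t M).
Proof.
rewrite [X in integrable _ _ X](_ : _ = (fun x => M%:R^-1%:E *
  (EFin \o (fun x => \sum_(j < M) h (x + t j))%R) x)%E)//.
exact: integrableZl.
Qed.

Lemma Rintegral_shift_avg t M : (0 < M)%N ->
  \int[mu]_(x in I) shift_avg h t M x = \int[mu]_(x in I) h x.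
Proof.
move=> M0; rewrite RintegralZl//.
have -> : \int[mu]_(x in I) (\sum_(j < M) h (x + t j)) = M%:R * \int[mu]_(x in I) h x.
  elim: M {M0} => [|M IH].
    under eq_Rintegral do rewrite big_ord0.
    by rewrite Rintegral_cst// !mul0r.
  under eq_Rintegral do rewrite big_ord_recr/=.
  rewrite RintegralD//; last 2 first.
  - exact: (integrable_shift_sum t M).
  - exact: integrable_periodic_shift.
  by rewrite IH Rintegral_periodic_shift// -natr1 mulrDl mul1r.
by rewrite mulrA mulVf ?mul1r// pnatr_eq0 -lt0n.
Qed.

End real_periodic.

(** * Complex exponentials and L1 *)

Section complex_numbers.
Context {R : realType}.
Local Notation C := R[i].

Lemma normcE_norm (z : C) : `|z| = (Normc.normc z)%:C.
Proof. by case: z => a b; rewrite normc_def. Qed.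

Lemma ler_norm_Re (z : C) : `|complex.Re z| <= Normc.normc z.
Proof. by rewrite -lecR -normcE_norm normc_ge_Re. Qed.

Lemma ler_norm_Im (z : C) : `|complex.Im z| <= Normc.normc z.
Proof. by case: z => a b /=; rewrite -sqrtr_sqr ler_wsqrtr// lerDr sqr_ge0. Qed.

Lemma normc_ge0 (z : C) : 0 <= Normc.normc z.
Proof. by case: z => a b; exact: sqrtr_ge0. Qed.

Lemma normc_leD (z : C) : Normc.normc z <= `|complex.Re z| + `|complex.Im z|.
Proof.
case: z => a b /=.
have -> : `|a| + `|b| = Num.sqrt ((`|a| + `|b|) ^+ 2).
  by rewrite sqrtr_sqr [RHS]ger0_norm ?addr_ge0.
rewrite ler_sqrt ?sqr_ge0// -[a ^+ 2]real_normK ?num_real// -[b ^+ 2]real_normK ?num_real//.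
by rewrite sqrrD addrAC lerDl mulrn_wge0// mulr_ge0.
Qed.

Lemma cexpiD (a b : R) : cexpi (a + b) = cexpi a * cexpi b.
Proof. by rewrite /cexpi cosD sinD; simpc; congr (_ +i* _); rewrite addrC. Qed.

Lemma cexpi0 : cexpi (0 : R) = 1.
Proof. by rewrite /cexpi cos0 sin0. Qed.

Lemma cexpiNK (a : R) : cexpi (- a) * cexpi a = 1.
Proof. by rewrite -cexpiD addNr cexpi0. Qed.

Lemma normc_cexpi (a : R) : Normc.normc (cexpi a) = 1.
Proof. by rewrite /= cos2Dsin2 sqrtr1. Qed.

End complex_numbers.

Section L1_spectral.
Context {R : realType}.
Local Notation C := R[i].
Local Notation mu := (@lebesgue_measure R).
Local Notation I := `[- pi, pi]%classic.
Local Open Scope quotient_scope.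

Lemma mul_cexpi_subproof (k : int) (f : L1fun R) :
  (fun x => f x * cexpi (- (k%:~R * x))) \in @L1_pred R.
Proof.
have /L1_predP[pf mf1 mf2 if1 if2] := L1valP f.
have mcs (h : R -> R) : continuous h ->
    measurable_fun [set: R] (fun x : R => h (- (k%:~R * x))).
  move=> ch; apply: (measurableT_comp (continuous_measurable_fun ch)).
  apply: continuous_measurable_fun => x; apply: continuousN.
  exact: mulrl_continuous.
have mc := mcs _ (@continuous_cos R); have ms := mcs _ (@continuous_sin R).
have mRe : measurable_fun [set: R] (fun x => complex.Re (f x * cexpi (- (k%:~R * x)))).
  apply: (eq_measurable_fun (fun x => complex.Re (f x) * cos (- (k%:~R * x))
    - complex.Im (f x) * sin (- (k%:~R * x)))).
    by move=> x _; case: (f x).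
  by apply: measurable_funB; exact: measurable_funM.
have mIm : measurable_fun [set: R] (fun x => complex.Im (f x * cexpi (- (k%:~R * x)))).
  apply: (eq_measurable_fun (fun x => complex.Re (f x) * sin (- (k%:~R * x))
    + complex.Im (f x) * cos (- (k%:~R * x)))).
    by move=> x _; case: (f x).
  by apply: measurable_funD; exact: measurable_funM.
have idom : mu.-integrable I ((fun x => `|(complex.Re (f x))%:E|) \+
    (fun x => `|(complex.Im (f x))%:E|))%E.
  by apply: integrableD => //; exact: integrable_abse.
have dom x : Normc.normc (f x * cexpi (- (k%:~R * x))) <=
    `|complex.Re (f x)| + `|complex.Im (f x)|.
  by rewrite Normc.normcM normc_cexpi mulr1 normc_leD.
have /L1_predP[pe _ _ _ _] := cexpi_subproof R (- k).
apply/L1_predP; split => //.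
- move=> x; rewrite pf; congr (_ * _).
  by have := pe x; rewrite intrN !mulNr.
- apply: (le_integrable _ _ _ idom) => //; first exact/measurable_EFinP/measurable_funTS.
  move=> x _ /=; rewrite lee_fin; apply: le_trans (ler_norm _).
  exact: le_trans (ler_norm_Re _) (dom x).
- apply: (le_integrable _ _ _ idom) => //; first exact/measurable_EFinP/measurable_funTS.
  move=> x _ /=; rewrite lee_fin; apply: le_trans (ler_norm _).
  exact: le_trans (ler_norm_Im _) (dom x).
Qed.

(** Moves frequency k to frequency 0: the k-th Fourier coefficient of [f] is the mean of
    [demodulate k f] over a period. *)
Definition demodulate (k : int) (f : L1fun R) : L1fun R := MkL1fun (mul_cexpi_subproof k f).

Lemma L1T_pi0 : \pi_(L1T R) (0 : L1fun R) = 0.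
Proof. by apply: (@addrI _ (\pi_(L1T R) 0)); rewrite -L1T_piD !addr0. Qed.

Lemma L1T_pi_sum n (F : 'I_n -> L1fun R) :
  \pi_(L1T R) (\sum_(j < n) F j) = \sum_(j < n) \pi_(L1T R) (F j).
Proof. exact: (big_morph _ (@L1T_piD R) L1T_pi0). Qed.

Lemma L1fun_sumE n (F : 'I_n -> L1fun R) x : (\sum_(j < n) F j) x = \sum_(j < n) F j x.
Proof. by apply: (big_morph (fun G : L1fun R => G x)). Qed.

Lemma integrable_normc (f : L1fun R) : mu.-integrable I (EFin \o (fun x => Normc.normc (f x))).
Proof.
have /L1_predP[pf mf1 mf2 if1 if2] := L1valP f.
have mn : measurable_fun [set: R] (fun x => Normc.normc (f x)).
  apply: (eq_measurable_fun (fun x =>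
    Num.sqrt (complex.Re (f x) ^+ 2 + complex.Im (f x) ^+ 2))).
    by move=> x _; case: (f x).
  apply: (measurableT_comp (continuous_measurable_fun (@sqrt_continuous R))).
  by apply: measurable_funD; exact: measurable_funX.
have idom : mu.-integrable I ((fun x => `|(complex.Re (f x))%:E|) \+
    (fun x => `|(complex.Im (f x))%:E|))%E.
  by apply: integrableD => //; exact: integrable_abse.
apply: (le_integrable _ _ _ idom) => //; first exact/measurable_EFinP/measurable_funTS.
move=> x _ /=; rewrite lee_fin; rewrite (ger0_norm (normc_ge0 _)) ger0_norm ?addr_ge0//.
exact: normc_leD.
Qed.

End L1_spectral.

Section spectral_mean.
Context {R : realType}.
Local Notation C := R[i].
Local Notation mu := (@lebesgue_measure R).
Local Notation I := `[- pi, pi]%classic.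
Local Open Scope quotient_scope.

(** The bound is uniform in [s], so it survives averaging over [s], which replaces the shift average
    by the mean of [q]. Hence the integral of |g - c| over a period is at most every positive
    [eps]. *)
Lemma ae_eq_mean (g q : R -> R) : measurable_fun [set: R] g ->
  periodic g (pi *+ 2) -> mu.-integrable I (EFin \o g) ->
  measurable_fun [set: R] q -> periodic q (pi *+ 2) ->
  mu.-integrable I (EFin \o q) ->
  (forall eps : R, 0 < eps -> exists M (t : nat -> R), (0 < M)%N /\
    forall s, \int[mu]_(x in I) `|g x - shift_avg q t M (x + s)| <= eps) ->
  {ae mu, forall x, g x = (pi *+ 2)^-1 * \int[mu]_(x in I) q x}.
Proof.
move=> mg pg ig mq pq iq H; set c := _ * _.
have ic := integrable_cst_period c.
have idiff : mu.-integrable I (EFin \o (fun x => g x - c)).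
  rewrite [X in integrable _ _ X](_ : _ = ((EFin \o g) \- (EFin \o cst c))%E)//.
  exact: integrableB.
have : {ae mu, forall x, g x - c = 0}.
  apply: periodic_integral_norm_eq0 => //.
  - exact: measurable_funB.
  - by move=> x; rewrite pg.
  apply/eqP; rewrite eq_le; apply/andP; split; last first.
    by apply: (@Rintegral_ge0 _ (measurableTypeR R)) => x _; exact: normr_ge0.
  apply/ler_addgt0Pl => eps eps0; rewrite addr0.
  have [M [t [M0 Ht]]] := H _ eps0.
  (* A shift average of [q] has the same mean as [q], so the deviation bound can be applied to the
     average. *)
  rewrite /c -(Rintegral_shift_avg mq pq iq t M0).
  apply: mean_deviation => //.
  - exact: measurable_shift_avg.
  - exact: periodic_shift_avg.
  - exact: integrable_shift_avg.
by apply: (@filterS _ _ (ae_filter_ringOfSetsType mu)) => x /= /eqP; rewrite subr_eq0 => /eqP.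
Qed.

Lemma Re_scale (a : R) (z : C) : complex.Re (a%:C * z) = a * complex.Re z.
Proof. by case: z => x y /=; rewrite mul0r subr0. Qed.

Lemma Im_scale (a : R) (z : C) : complex.Im (a%:C * z) = a * complex.Im z.
Proof. by case: z => x y /=; rewrite mul0r addr0. Qed.

Lemma Re_sum n (F : 'I_n -> C) : complex.Re (\sum_(j < n) F j) = \sum_(j < n) complex.Re (F j).
Proof. by apply: (big_morph (@complex.Re R)) => // -[a b] [c d]. Qed.

Lemma Im_sum n (F : 'I_n -> C) : complex.Im (\sum_(j < n) F j) = \sum_(j < n) complex.Im (F j).
Proof. by apply: (big_morph (@complex.Im R)) => // -[a b] [c d]. Qed.

(* After multiplication by e^(-imx), the averages of modulated translates of u
   become translates by s of averages of shifts of a single function, to which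
   the deviation bound applies. *)
Lemma spectral_mean (u g : L1T R) (m : int) :
  (forall eps : R, 0 < eps -> exists M (t : nat -> R), (0 < M)%N /\
    forall s, normL1 (g - (M%:R^-1)%:C *: \sum_(j < M)
       cexpi (- (m%:~R * (t j + s))) *: translate (t j + s) u) <= eps) ->
  g = fourier_coef u m *: expL1 R m.
Proof.
rewrite -[u]reprK -[g]reprK; move: (repr u) (repr g) => U G H {u g}.
pose V := demodulate m U; pose W := demodulate m G.
have /L1_predP[pV mV1 mV2 iV1 iV2] := L1valP V.
have /L1_predP[pW mW1 mW2 iW1 iW2] := L1valP W.
have p0 : 0 < pi *+ 2 :> R by rewrite pmulrn_lgt0// pi_gt0.
(* The bound between classes is transferred to a function [D] satisfying the identity at every
   point, so that real and imaginary parts can then be treated separately by the real-valued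
   result. *)
have key (eps : R) : 0 < eps -> exists M (t : nat -> R), (0 < M)%N /\
    forall s, exists2 D : L1fun R,
     (forall x, D x * cexpi (- (m%:~R * x)) =
        W x - (M%:R^-1)%:C * \sum_(j < M) V (x + s + t j)) &
     \int[mu]_(x in I) Normc.normc (D x) <= eps.
  (* The factor undoes the normalisation by 2 pi in [normL1]. *)
  move=> eps0; have [|M [t [M0 Ht]]] := H ((pi *+ 2)^-1 * eps).
    by rewrite mulr_gt0// invr_gt0.
  exists M, t; split => // s; have {Ht} := Ht s.
  pose A : L1fun R := (M%:R^-1)%:C *: \sum_(j < M)
    cexpi (- (m%:~R * (t j + s))) *: MkL1fun (translate_subproof (t j + s) U).
  have -> : (M%:R^-1)%:C *: (\sum_(j < M) cexpi (- (m%:~R * (t j + s))) *: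
      translate (t j + s) (\pi_(L1T R) U)) = \pi_(L1T R) A.
    rewrite L1T_piZ L1T_pi_sum; congr (_ *: _); apply: eq_bigr => j _.
    by rewrite L1T_piZ translate_pi.
  have -> : \pi_(L1T R) G - \pi_(L1T R) A = \pi_(L1T R) (G - A).
    by rewrite -[X in _ - X]scale1r -scaleNr -[X in _ + X]L1T_piZ -L1T_piD scaleN1r.
  rewrite normL1_pi ler_pM2l ?invr_gt0// => Hs; exists (G - A) => // x.
  rewrite -[(G - A) x]/(G x - (M%:R^-1)%:C * (\sum_(j < M)
    cexpi (- (m%:~R * (t j + s))) *: MkL1fun (translate_subproof (t j + s) U)) x).
  rewrite mulrBl; congr (_ - _); rewrite -mulrA; congr (_ * _).
  rewrite L1fun_sumE mulr_suml; apply: eq_bigr => j _.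
  rewrite -[LHS]/(cexpi (- (m%:~R * (t j + s))) * U (x + (t j + s)) * _).
  rewrite -[RHS]/(U _ * _) mulrAC -cexpiD mulrC; congr (U _ * cexpi _); ring.
have aeRe : {ae mu, forall x, complex.Re (W x) =
    (pi *+ 2)^-1 * \int[mu]_(x in I) complex.Re (V x)}.
  apply: ae_eq_mean => //.
  - by move=> x; rewrite pW.
  - by move=> x; rewrite pV.
  move=> eps eps0; have [M [t [M0 Ht]]] := key _ eps0; exists M, t; split=> // s.
  have [D HD lD] := Ht s; apply: le_trans lD.
  have E x : `|complex.Re (W x) - shift_avg (fun x => complex.Re (V x)) t M (x + s)| =
      `|complex.Re (demodulate m D x)|.
    rewrite -[demodulate m D x]/(D x * _) HD /shift_avg; congr `| _ |.
    rewrite -(Re_sum (fun j => V (x + s + t j))) -Re_scale.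
    by case: (W x) => a b; case: (_ * _) => c d.
  under eq_Rintegral do rewrite E.
  apply: le_Rintegral => //.
  - by have /L1_predP[_ _ _ i _] := L1valP (demodulate m D); exact: (integrable_norm i).
  - exact: integrable_normc.
  - move=> x _; apply: le_trans (ler_norm_Re _) _.
    by rewrite Normc.normcM normc_cexpi mulr1.
have aeIm : {ae mu, forall x, complex.Im (W x) =
    (pi *+ 2)^-1 * \int[mu]_(x in I) complex.Im (V x)}.
  apply: ae_eq_mean => //.
  - by move=> x; rewrite pW.
  - by move=> x; rewrite pV.
  move=> eps eps0; have [M [t [M0 Ht]]] := key _ eps0; exists M, t; split=> // s.
  have [D HD lD] := Ht s; apply: le_trans lD.
  have E x : `|complex.Im (W x) - shift_avg (fun x => complex.Im (V x)) t M (x + s)| =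
      `|complex.Im (demodulate m D x)|.
    rewrite -[demodulate m D x]/(D x * _) HD /shift_avg; congr `| _ |.
    rewrite -(Im_sum (fun j => V (x + s + t j))) -Im_scale.
    by case: (W x) => a b; case: (_ * _) => c d.
  under eq_Rintegral do rewrite E.
  apply: le_Rintegral => //.
  - by have /L1_predP[_ _ _ _ i] := L1valP (demodulate m D); exact: (integrable_norm i).
  - exact: integrable_normc.
  - move=> x _; apply: le_trans (ler_norm_Im _) _.
    by rewrite Normc.normcM normc_cexpi mulr1.
rewrite fourier_coef_pi /expL1 -[RHS]L1T_piZ; apply/L1T_eqP.
apply: (@filterS2 _ _ (ae_filter_ringOfSetsType mu) _ _ _ _ aeRe aeIm) => x /= E1 E2.
rewrite -[LHS]mulr1 -(cexpiNK (m%:~R * x)) mulrA.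
rewrite -[RHS]/(_ * cexpi (m%:~R * x)); congr (_ * _).
rewrite -[LHS]/(W x).
have -> : W x = complex.Re (W x) +i* complex.Im (W x) by case: (W x).
by rewrite E1 E2 /cintegral; simpc.
Qed.

End spectral_mean.

(** * Riemann sums of periodic vector-valued functions *)

Section real_norm.
Context {R : realType} {V : normedModType R[i]}.
Implicit Types (u v w : V) (a : R[i]).

(** The norm of a complex normed space takes values in [R[i]], whose order is partial; its real part
    brings the estimates into the ordered field [R]. *)
Definition rnorm v : R := complex.Re `|v|.

Lemma rnormE v : `|v| = (rnorm v)%:C.
Proof. by rewrite /rnorm RRe_real// normr_real. Qed.

Lemma rnorm_ge0 v : 0 <= rnorm v.
Proof. by rewrite -ler0c -rnormE. Qed.

Lemma rnorm0 : rnorm 0 = 0.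
Proof. by rewrite /rnorm normr0. Qed.

Lemma rnormD u v : rnorm (u + v) <= rnorm u + rnorm v.
Proof. by rewrite -lecR rmorphD/= -!rnormE ler_normD. Qed.

Lemma rnormZ a v : rnorm (a *: v) = Normc.normc a * rnorm v.
Proof.
by apply: complexI; rewrite -rnormE normrZ normcE_norm rnormE -rmorphM.
Qed.

Lemma rnormBC u v : rnorm (u - v) = rnorm (v - u).
Proof. by rewrite /rnorm distrC. Qed.

Lemma rnorm_dist u v w : rnorm (u - w) <= rnorm (u - v) + rnorm (v - w).
Proof. by rewrite -[u - w](subrKA v); exact: rnormD. Qed.

Lemma rnorm_sum n (F : 'I_n -> V) : rnorm (\sum_(j < n) F j) <= \sum_(j < n) rnorm (F j).
Proof.
elim/big_ind2: _ => [|x a y b xa yb|//]; first by rewrite rnorm0.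
exact: le_trans (rnormD _ _) (lerD xa yb).
Qed.

Lemma normc_real (r : R) : 0 <= r -> Normc.normc r%:C = r.
Proof. by move=> r0; rewrite /= expr0n/= addr0 sqrtr_sqr ger0_norm. Qed.

Lemma cvg_rnormP {T : Type} {F : set_system T} {FF : Filter F} (f : T -> V) v :
  f x @[x --> F] --> v <-> forall eps : R, 0 < eps -> \near F, rnorm (v - f F) < eps.
Proof.
split=> [/cvgrPdist_lt H eps eps0|H].
  have := H eps%:C; rewrite ltcR => /(_ eps0).
  by apply: filterS => x; rewrite rnormE ltcR.
apply/cvgrPdist_lt => -[a b]; rewrite ltcE/= => /andP[/eqP-> a0].
by apply: filterS (H _ a0) => x; rewrite rnormE ltcR.
Qed.

End real_norm.

Section modulus.
Context {R : realType} {V : normedModType R[i]}.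
Variable phi : R -> V.
Hypotheses (cphi : continuous phi) (pphi : periodic phi (pi *+ 2)).

(** Heine's theorem on the compact period [0, 2 pi]. The point [t + r] may leave that interval, so
    [P] refers to [phi] on the whole line. *)
Lemma periodic_unif_continuous (eps : R) : 0 < eps ->
  exists2 eta : R, 0 < eta &
    forall t r, `|r| < eta -> rnorm (phi (t + r) - phi t) <= eps.
Proof.
move=> eps0.
pose P (eta t : R) := forall r, `|r| < eta -> rnorm (phi (t + r) - phi t) <= eps.
have : \forall eta \near (0 : R)^'+, `[0, pi *+ 2] `<=` P eta.
  have /compact_near_coveringP cK := @segment_compact R 0 (pi *+ 2).
  apply: cK => t _.
  have e2 : 0 < eps / 2 by rewrite divr_gt0.
  have /cvg_rnormP/(_ _ e2)/nbhs_ballP[d /= d0 Hd] := @cphi t.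
  have d2 : 0 < d / 2 by rewrite divr_gt0.
  exists (ball t (d / 2), [set eta | eta < d / 2]) => /=.
    by split; [exact: nbhsx_ballx|exact: nbhs_right_lt].
  move=> [t' eta] /= [tt' etad] r reta.
  have H x : `|t - x| < d -> rnorm (phi t - phi x) < eps / 2 by exact: Hd.
  rewrite (splitr eps); apply: le_trans (rnorm_dist _ (phi t) _) _.
  rewrite rnormBC; apply: lerD; apply/ltW/H.
    rewrite opprD addrA (splitr d); apply: le_lt_trans (ler_normB _ _) _.
    by apply: ltrD => //; exact: lt_trans etad.
  by apply: lt_trans tt' _; rewrite ltr_pdivrMr// ltr_pMr// ltr1n.
move=> H; have [eta [eta0 Heta]] : exists eta : R, 0 < eta /\ `[0, pi *+ 2] `<=` P eta.
  have [eta [? ?]] := @filter_ex _ _ _ _ (filterI (nbhs_right_gt (0 : R)) H).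
  by exists eta.
exists eta => // t r reta.
have [|k /andP[k0 k1]] := @periodic_reduction R (pi *+ 2) t 0.
  by rewrite pmulrn_lgt0// pi_gt0.
rewrite -(periodicz k (t + r) pphi) -(periodicz k t pphi) addrAC.
by apply: Heta => //=; rewrite in_itv/= k0/= -[leRHS]add0r ltW.
Qed.

Lemma periodic_bounded : exists B : R, forall t, rnorm (phi t) <= B.
Proof.
have [eta eta0 H] := periodic_unif_continuous ltr01.
have : \forall B \near +oo, `[0, pi *+ 2] `<=` (fun t => rnorm (phi t) <= B).
  have /compact_near_coveringP cK := @segment_compact R 0 (pi *+ 2).
  apply: cK => t _.
  exists (ball t eta, [set B | 1 + rnorm (phi t) <= B]) => /=.
    by split; [exact: nbhsx_ballx|apply: nbhs_pinfty_ge; exact: num_real].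
  move=> [t' B] /= [tt' Ht].
  apply: le_trans Ht; rewrite -[phi t'](subrK (phi t)).
  apply: le_trans (rnormD _ _) _; rewrite lerD2r.
  by have := H t (t' - t); rewrite subrKC; apply; rewrite distrC.
move=> /filter_ex[B HB]; exists B => t.
have [|k /andP[k0 k1]] := @periodic_reduction R (pi *+ 2) t 0.
  by rewrite pmulrn_lgt0// pi_gt0.
rewrite -(periodicz k t pphi); apply: HB => /=.
by rewrite in_itv/= k0/= -[leRHS]add0r ltW.
Qed.

End modulus.

Lemma continuous_cexpi {R : realType} : continuous (@cexpi R : R -> (R[i] : numFieldType)).
Proof.
move=> t; apply/cvgrPdist_lt => -[a b]; rewrite ltcE/= => /andP[/eqP-> a0].
have a2 : 0 < a / 2 by rewrite divr_gt0.
have /cvgrPdist_lt/(_ _ a2) c := @continuous_cos R t.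
have /cvgrPdist_lt/(_ _ a2) s := @continuous_sin R t.
apply: filterS2 c s => x cx sx.
rewrite normcE_norm ltcR; apply: le_lt_trans (normc_leD _) _ => /=.
by rewrite (splitr a) ltrD.
Qed.

Lemma continuous_modulation {R : realType} {V : normedModType R[i]} (phi : R -> V) (m : int) :
  continuous phi -> continuous (fun t : R => cexpi (- (m%:~R * t)) *: phi t).
Proof.
move=> cphi t; apply: (@cvgZ (R[i] : numFieldType)); last exact: cphi.
apply: (continuous_comp (f := fun t : R => - (m%:~R * t))); last exact: continuous_cexpi.
by apply: continuousN; exact: mulrl_continuous.
Qed.

Section riemann_sums.
Context {R : realType}.
Local Notation C := R[i].

Definition grid (M j : nat) : R := (pi *+ 2 / M%:R) * j%:R.

(** A Riemann sum for the mean of [phi], not its integral, on the grid moved by [s]. *)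
Definition rsum {V : normedModType C} (phi : R -> V) (M : nat) (s : R) : V :=
  (M%:R^-1)%:C *: \sum_(j < M) phi (grid M j + s).

Context {V : normedModType C}.

Lemma rnorm_avg M (F : 'I_M -> V) (eps : R) : (0 < M)%N ->
  (forall j, rnorm (F j) <= eps) -> rnorm ((M%:R^-1)%:C *: \sum_(j < M) F j) <= eps.
Proof.
move=> M0 H; rewrite rnormZ normc_real ?invr_ge0//.
rewrite ler_pdivrMl ?ltr0n//; apply: le_trans (rnorm_sum _) _.
apply: le_trans (ler_sum _ (fun j _ => H j)) _.
by rewrite sumr_const card_ord mulr_natl.
Qed.

Lemma scaler_avg_const M (v : V) : (0 < M)%N -> (M%:R^-1)%:C *: \sum_(j < M) v = v.
Proof.
move=> M0; rewrite sumr_const card_ord -[v *+ M]scaler_nat scalerA.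
rewrite -(rmorph_nat (real_complex R)) -rmorphM mulVf ?pnatr_eq0 -?lt0n//.
by rewrite rmorph1 scale1r.
Qed.

Variable phi : R -> V.
Hypothesis pphi : periodic phi (pi *+ 2).

(** Moving the grid by one mesh permutes its nodes, up to one node that wraps around by a full
    period. *)
Lemma periodic_rsum M : (0 < M)%N -> periodic (rsum phi M) (pi *+ 2 / M%:R).
Proof.
case: M => // M _ s; congr (_ *: _).
rewrite big_ord_recr big_ord_recl/= addrC; congr (_ + _).
  rewrite /grid mulr0 add0r addrCA -[X in _ + (_ + X)]mulr1 -mulrDr natr1.
  by rewrite divfK ?pnatr_eq0// pphi.
apply: eq_bigr => j _; congr phi.
rewrite -[RHS]/(grid M.+1 j.+1 + s) /grid -[j.+1%:R]natr1 mulrDr mulr1.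
by rewrite addrA addrAC.
Qed.

Variables (eta eps : R).
Hypothesis mod_phi : forall t r, `|r| < eta -> rnorm (phi (t + r) - phi t) <= eps.

(** Because [rsum] has the mesh as a period, two offsets may be assumed to differ by less than one
    mesh; this gives the uniformity in [s]. *)
Lemma rsum_shift M (s s' : R) : (0 < M)%N -> pi *+ 2 / M%:R < eta ->
  rnorm (rsum phi M s - rsum phi M s') <= eps.
Proof.
move=> M0 Meta.
have d0 : 0 < pi *+ 2 / M%:R :> R by rewrite divr_gt0 ?ltr0n// pmulrn_lgt0// pi_gt0.
have [k] := @periodic_reduction R _ s s' d0.
rewrite -(periodicz k s (periodic_rsum M0)); move: (s + _) => {}s /andP[ss' s's].
rewrite /rsum -scalerBr -sumrB; apply: rnorm_avg => // j.
have -> : grid M j + s = grid M j + s' + (s - s') by rewrite -addrA subrKC.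
apply: mod_phi; rewrite ger0_norm ?subr_ge0//.
by apply: lt_trans Meta; rewrite ltrBlDl.
Qed.

(* Both Riemann sums are close to the sum over the product of the two grids. *)
Lemma rsum_cauchy M M' : (0 < M)%N -> (0 < M')%N ->
  pi *+ 2 / M%:R < eta -> pi *+ 2 / M'%:R < eta ->
  rnorm (rsum phi M 0 - rsum phi M' 0) <= eps + eps.
Proof.
move=> M0 M'0 Meta M'eta.
pose D := (M'%:R^-1)%:C *: \sum_(i < M') rsum phi M (grid M' i).
have DE : D = (M%:R^-1)%:C *: \sum_(j < M) rsum phi M' (grid M j).
  rewrite /D /rsum -!scaler_sumr !scalerA mulrC; congr (_ *: _).
  rewrite exchange_big/=; apply: eq_bigr => j _; apply: eq_bigr => i _.
  by rewrite addrC.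
apply: le_trans (rnorm_dist _ D _) _; apply: lerD.
  rewrite -[X in X - _](scaler_avg_const _ M'0) -scalerBr -sumrB.
  by apply: rnorm_avg => // i; exact: rsum_shift.
rewrite rnormBC -[X in X - _](scaler_avg_const _ M0) DE -scalerBr -sumrB.
by apply: rnorm_avg => // i; exact: rsum_shift.
Qed.

End riemann_sums.

Section riemann_limit.
Context {R : realType} {V : completeNormedModType R[i]}.
Variable phi : R -> V.
Hypotheses (cphi : continuous phi) (pphi : periodic phi (pi *+ 2)).

Lemma fine_grid (eta : R) : 0 < eta ->
  exists N : nat, forall M, (N <= M)%N -> (0 < M)%N /\ pi *+ 2 / M%:R < eta.
Proof.
move=> eta0; exists (Num.Def.archi_bound (pi *+ 2 / eta)).+1 => M NM.
have M0 : (0 < M)%N by exact: leq_trans NM.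
split => //; rewrite ltr_pdivrMr ?ltr0n// mulrC -ltr_pdivrMr//.
apply: lt_le_trans (archi_boundP _) _; last by rewrite ler_nat ltnW.
by apply: divr_ge0; [rewrite mulrn_wge0// pi_ge0|exact: ltW].
Qed.

Lemma rsum_cvg : exists g : V, forall eps : R, 0 < eps ->
  exists N, forall M, (N <= M)%N -> (0 < M)%N /\ forall s, rnorm (g - rsum phi M s) <= eps.
Proof.
have cau : cauchy (rsum phi n 0 @[n --> \oo]).
  apply: cauchy_exP => -[a b]; rewrite ltcE/= => /andP[/eqP-> a0].
  have a4 : 0 < a / 4 by rewrite divr_gt0.
  have [eta eta0 H] := periodic_unif_continuous cphi pphi a4.
  have [N HN] := fine_grid eta0; have [N0 Neta] := HN _ (leqnn N).
  exists (rsum phi N 0); exists N => // M /= /HN[M0 Meta].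
  rewrite -ball_normE/= rnormE ltcR.
  by apply: le_lt_trans (rsum_cauchy pphi H N0 M0 Neta Meta) _; lra.
move: cau => /cauchy_cvgP/cvg_rnormP cg; set g := lim _ in cg.
exists g => eps eps0.
(* One quarter for the distance from the limit to a very fine sum, two for comparing two grids, one
   for the offset. *)
have e4 : 0 < eps / 4 by rewrite divr_gt0.
have [eta eta0 H] := periodic_unif_continuous cphi pphi e4.
have [N HN] := fine_grid eta0.
exists N => M /HN[M0 Meta]; split => // s.
have [K _ HK] := cg _ e4.
have [K0 Keta] := HN (maxn N K) (leq_maxl _ _).
have {}HK := HK _ (leq_maxr N K).
apply: le_trans (rnorm_dist _ (rsum phi (maxn N K) 0) _) _.
apply: le_trans (lerD (ltW HK) (rnorm_dist _ (rsum phi M 0) _)) _.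
have h1 := rsum_cauchy pphi H K0 M0 Keta Meta.
have h2 := rsum_shift pphi H 0 s M0 Meta.
lra.
Qed.

End riemann_limit.

(** * The Fejer kernel *)

(** Enlarging the square from N to N + 1 adds a row and a column whose differences run once through
    - N, ..., N: the indices of the next symmetric partial sum. *)
Lemma sum_differences (V : zmodType) (a : int -> V) (N : nat) :
  \sum_(j < N) \sum_(l < N) a (j%:Z - l%:Z) =
  \sum_(k < N) \sum_(i < k.*2.+1) a (i%:Z - k%:Z).
Proof.
elim: N => [|N IH]; first by rewrite !big_ord0.
rewrite [RHS]big_ord_recr -IH big_ord_recr/=.
under eq_bigr do rewrite big_ord_recr/=.
rewrite big_split/= -addrA; congr (_ + _).
have -> : N.*2.+1 = (N + N.+1)%N by rewrite -addnn addnS.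
rewrite big_split_ord/=; congr (_ + _).
rewrite (reindex_inj rev_ord_inj)/=; apply: eq_bigr => i _; congr a.
by have := ltn_ord i; lia.
Qed.

Section fejer_kernel.
Context {R : realType}.
Local Notation C := R[i].

Lemma cexpi_natmul (n : nat) (x : R) : cexpi (n%:R * x) = cexpi x ^+ n.
Proof.
elim: n => [|n IH]; first by rewrite mul0r cexpi0.
by rewrite -natr1 mulrDl mul1r cexpiD IH exprSr.
Qed.

Lemma cexpi2pi (k : int) : cexpi (k%:~R * (pi *+ 2) : R) = 1.
Proof.
have /L1_predP[pe _ _ _ _] := cexpi_subproof R k.
by have := pe 0; rewrite add0r mulr0 cexpi0.
Qed.

Lemma conjc_cexpi (x : R) : (cexpi x)^* = cexpi (- x).
Proof. by rewrite /cexpi cosN sinN. Qed.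

(** With y = pi |m| / M in (0, pi), the real part is cos 2y = 1 - 2 sin^2 y < 1. *)
Lemma cexpi_neq1 (m : int) (M : nat) : m != 0 -> (`|m| < M)%N ->
  cexpi (- (m%:~R * (pi *+ 2 / M%:R)) : R) != 1.
Proof.
move=> m0 mM; apply/eqP => -[c1 _]; move: c1; rewrite cosN.
pose y : R := pi * `|m|%N%:R / M%:R.
have M0 : 0 < M%:R :> R by rewrite ltr0n; exact: leq_ltn_trans mM.
have ypi : 0 < y < pi.
  rewrite /y divr_gt0//= ?mulr_gt0 ?pi_gt0 ?ltr0n ?absz_gt0//.
  by rewrite ltr_pdivrMr// ltr_pM2l ?pi_gt0// ltr_nat.
have -> : cos (m%:~R * (pi *+ 2 / M%:R)) = cos (y *+ 2).
  have -> : y *+ 2 = `|m|%N%:R * (pi *+ 2 / M%:R) by rewrite /y; ring.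
  by case: (intP m) => [//|n|n]; rewrite ?NegzE ?mulrNz ?mulNr ?cosN ?abszN.
have := sin_gt0_pi ypi; rewrite cos_mulr2n => s0 c1.
have := cos2Dsin2 y; have : 0 < sin y ^+ 2 by exact: exprn_gt0.
move: c1; lra.
Qed.

(** For m != 0 this is a geometric sum whose ratio is an M-th root of unity other than 1. *)
Lemma grid_orthogonality (m : int) (M : nat) : (`|m| < M)%N ->
  (M%:R^-1)%:C * \sum_(i < M) cexpi (- (m%:~R * grid M i)) = (m == 0)%:R :> C.
Proof.
move=> mM; have M0 : M%:R != 0 :> R by rewrite pnatr_eq0 -lt0n (leq_ltn_trans _ mM).
have [->|m0] := eqVneq m 0.
  under eq_bigr do rewrite mul0r oppr0 cexpi0.
  rewrite sumr_const card_ord -(rmorph_nat (real_complex R)) -rmorphM mulVf//.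
pose w : C := cexpi (- (m%:~R * (pi *+ 2 / M%:R))).
have -> : \sum_(i < M) cexpi (- (m%:~R * grid M i)) = \sum_(i < M) w ^+ i.
  apply: eq_bigr => i _; rewrite -cexpi_natmul; congr cexpi.
  by rewrite /grid; ring.
suff /eqP : (w - 1) * (\sum_(i < M) w ^+ i) = 0.
  by rewrite mulf_eq0 subr_eq0 (negbTE (cexpi_neq1 m0 mM)) => /eqP->; rewrite mulr0.
rewrite -subrX1 -cexpi_natmul [_ * _](_ : _ = (- m)%:~R * (pi *+ 2)).
  by rewrite cexpi2pi subrr.
by rewrite mulrNz; field.
Qed.

(* The one-sided kernel: its squared modulus is N times the Fejer kernel. *)
Definition dirichlet (N : nat) (t : R) : C := \sum_(j < N) cexpi t ^+ j.

Lemma fejer_kernelE N (t : R) :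
  \sum_(j < N) \sum_(l < N) cexpi (- ((j%:Z - l%:Z)%:~R * t)) =
  (Normc.normc (dirichlet N t) ^+ 2)%:C.
Proof.
rewrite rmorphXn/= -normcE_norm sqr_normc mulrC /dirichlet rmorph_sum/= mulr_suml.
apply: eq_bigr => j _; rewrite mulr_sumr; apply: eq_bigr => l _.
rewrite -!cexpi_natmul conjc_cexpi -cexpiD; congr cexpi.
by rewrite intrD mulrNz; ring.
Qed.

(** With w = e^(it), (w - 1) times the geometric sum is w^N - 1, of modulus at most 2. The product
    form also covers w = 1. *)
Lemma fejer_kernel_decay N (t : R) :
  Normc.normc (dirichlet N t) ^+ 2 * Normc.normc (cexpi t - 1) ^+ 2 <= 4.
Proof.
rewrite -exprMn -Normc.normcM mulrC -subrX1.
have -> : 4 = 2 ^+ 2 :> R by ring.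
rewrite ler_pXn2r ?nnegrE ?normc_ge0//.
rewrite -lecR -normcE_norm; apply: le_trans (ler_normB _ _) _.
by rewrite normr1 normcE_norm -cexpi_natmul normc_cexpi rmorphD rmorph1.
Qed.

(** Only the N diagonal pairs survive orthogonality, which applies since all differences are smaller
    than N, hence than M, in absolute value. *)
Lemma fejer_kernel_mean N M : (N <= M)%N ->
  (M%:R^-1) * \sum_(i < M) (Normc.normc (dirichlet N (grid M i)) ^+ 2) = N%:R :> R.
Proof.
move=> NM; apply: complexI; rewrite rmorphM rmorph_sum/=.
under eq_bigr do rewrite -fejer_kernelE.
rewrite exchange_big/= mulr_sumr rmorph_nat -[X in _ = X%:R](card_ord N) -sumr_const.
apply: eq_bigr => j _; rewrite exchange_big/= mulr_sumr.
rewrite (bigD1 j)//= subrr grid_orthogonality ?(leq_trans _ NM)//=.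
  rewrite big1 ?addr0// => l lj; rewrite grid_orthogonality//.
    by rewrite subr_eq0 eqz_nat eq_sym -[(l == j :> nat)]/(l == j) (negbTE lj).
  by have := ltn_ord j; have := ltn_ord l; lia.
by have := ltn_ord j; lia.
Qed.

Lemma normc_cexpi_sub1 (t : R) : Normc.normc (cexpi t - 1) ^+ 2 = 2 - 2 * cos t.
Proof.
rewrite /= sqr_sqrtr ?addr_ge0 ?sqr_ge0//.
by have := cos2Dsin2 t; rewrite oppr0 addr0; nra.
Qed.

End fejer_kernel.

(** * Cesaro convergence in homogeneous Banach spaces *)

Section translation.
Context {R : realType}.
Local Open Scope quotient_scope.

Lemma translateD (a b : R) (u : L1T R) : translate (a + b) u = translate a (translate b u).
Proof.
rewrite -[u]reprK; move: (repr u) => U {u}.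
rewrite (translate_pi b) !translate_pi; apply/L1T_eqP; apply: aeW => x /=.
by rewrite addrA.
Qed.

Lemma translate2pi (u : L1T R) : translate (pi *+ 2) u = u.
Proof.
rewrite -[u]reprK; move: (repr u) => U {u}.
rewrite translate_pi; apply/L1T_eqP; apply: aeW => x /=.
by have /L1_predP[pU _ _ _ _] := L1valP U; exact: pU.
Qed.

Lemma translate0 (u : L1T R) : translate 0 u = u.
Proof.
rewrite -[u]reprK; move: (repr u) => U {u}.
by rewrite translate_pi; apply/L1T_eqP; apply: aeW => x /=; rewrite addr0.
Qed.

End translation.

Section homogeneous_space.
Context {R : realType} {X : completeNormedModType R[i]}.
Variables (iota : {linear X -> L1T R}) (tau : R -> X -> X) (e : int -> X) (c : R).
Hypotheses (iota_inj : injective iota)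
  (htau : forall (a : R) (f : X), iota (tau a f) = translate a (iota f))
  (he : forall k : int, iota (e k) = expL1 R k)
  (c_gt0 : 0 < c)
  (H1 : forall f : X, (normL1 (iota f))%:C <= c%:C * `|f|)
  (H2 : forall f : X, tau a f - f @[a --> (0 : R)] --> (0 : X)).

Lemma tauD a b f : tau (a + b) f = tau a (tau b f).
Proof. by apply: iota_inj; rewrite !htau translateD. Qed.

Lemma periodic_tau f : periodic (tau^~ f) (pi *+ 2).
Proof. by move=> t; apply: iota_inj; rewrite !htau translateD translate2pi. Qed.

Lemma tau0 f : tau 0 f = f.
Proof. by apply: iota_inj; rewrite htau translate0. Qed.

(** By the group law, continuity at [t] is hypothesis (2) for the vector [tau t f]. *)
Lemma continuous_tau f : continuous (tau^~ f).
Proof.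
move=> t; apply/cvg_rnormP => eps eps0.
have /cvg_rnormP/(_ _ eps0)/nbhs_ballP[d /= d0 Hd] := H2 (tau t f).
apply/nbhs_ballP; exists d => //= y ty.
have := Hd (y - t); rewrite -tauD subrK /= !sub0r opprB; apply.
by rewrite /ball/= sub0r opprB.
Qed.

Lemma normL1_le (f : X) : normL1 (iota f) <= c * rnorm f.
Proof. by rewrite -lecR; apply: le_trans (H1 f) _; rewrite rnormE rmorphM. Qed.

Variable f : X.
Let phi (m : int) (t : R) : X := cexpi (- (m%:~R * t)) *: tau t f.

Let continuous_phi m : continuous (phi m).
Proof. by apply: (@continuous_modulation R X (tau^~ f)) => t; exact: continuous_tau. Qed.

Let periodic_phi m : periodic (phi m) (pi *+ 2).
Proof.
move=> t; rewrite /phi periodic_tau; congr (_ *: _).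
by rewrite mulrDr opprD cexpiD -[X in _ * cexpi X]mulNr -intrN cexpi2pi mulr1.
Qed.

Lemma fourier_mode (m : int) (eps : R) : 0 < eps ->
  exists N, forall M, (N <= M)%N -> (0 < M)%N /\
    rnorm (fourier_coef (iota f) m *: e m - rsum (phi m) M 0) <= eps.
Proof.
have [g Hg] := rsum_cvg (@continuous_phi m) (@periodic_phi m).
suff <- : g = fourier_coef (iota f) m *: e m.
  by move=> /Hg[N HN]; exists N => M /HN[M0 +]; split.
apply: iota_inj; rewrite linearZ/= he; apply: spectral_mean => eta eta0.
(* Division by [c] compensates for the bound on [iota]. *)
have [|N HN] := Hg (eta / c); first by rewrite divr_gt0.
have [N0 {}HN] := HN _ (leqnn N); exists N, (grid N); split => // s.
have -> : (N%:R^-1)%:C *: (\sum_(j < N) cexpi (- (m%:~R * (grid N j + s))) *: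
    translate (grid N j + s) (iota f)) = iota (rsum (phi m) N s).
  apply: (etrans _ (esym (linearZ _ _))); congr (_ *: _).
  rewrite linear_sum; apply: eq_bigr => j _.
  by apply: (etrans _ (esym (linearZ _ _))); rewrite htau.
rewrite -linearB; apply: le_trans (normL1_le _) _.
by rewrite mulrC -ler_pdivlMr//; exact: HN.
Qed.

(* [|e^(it) - 1|^2] is the weight cancelled by the decay of the Fejer kernel. *)
Lemma modulus_at_origin (eps : R) : 0 < eps -> exists2 C : R, 0 <= C &
  forall t, rnorm (tau t f - f) <= eps + C * Normc.normc (cexpi t - 1) ^+ 2.
Proof.
move=> eps0.
have [eta eta0 Heta] := periodic_unif_continuous (@continuous_tau f) (@periodic_tau f) eps0.
have [B HB] := periodic_bounded (@continuous_tau f) (@periodic_tau f).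
(* For |t| <= pi outside the [eta]-neighbourhood of 0, the weight 2 - 2 cos t is at least [d] and
   the left side at most 2 B, whence the constant 2 B / d. The cap at pi keeps [eta'] where cos
   decreases. *)
pose eta' := Num.min eta pi.
have eta'0 : 0 < eta' by rewrite lt_min eta0 pi_gt0.
have eta'pi : eta' <= pi by rewrite ge_min lexx orbT.
pose d := 2 - 2 * cos eta'.
have d0 : 0 < d.
  have : cos eta' < cos 0 by rewrite ltr_cos// in_itv/= ?lexx ?pi_ge0// ltW.
  by rewrite /d cos0; lra.
have B0 : 0 <= B := le_trans (rnorm_ge0 _) (HB 0).
have C0 : 0 <= (B + B) / d by apply: divr_ge0; [exact: addr_ge0|exact: ltW].
exists ((B + B) / d) => // t; rewrite normc_cexpi_sub1.
have [|k] := @periodic_reduction R (pi *+ 2) t (- pi).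
  by rewrite pmulrn_lgt0// pi_gt0.
rewrite -(periodicz k t (@periodic_tau f)) -(periodicz k t (@cosD2pi R)).
move: (t + _) => {}t /andP[t1 t2].
have tpi : `|t| <= pi by rewrite ler_norml; apply/andP; split; lra.
have cge0 : 0 <= 2 - 2 * cos t by have := cos_le1 t; lra.
have [tlt|tge] := ltP `|t| eta.
  have := Heta 0 t tlt; rewrite add0r tau0 => /le_trans; apply.
  by rewrite lerDl mulr_ge0.
have ct : cos t <= cos eta'.
  have It : `|t| \in `[0, pi] by rewrite in_itv/= normr_ge0.
  have Ieta : eta' \in `[0, pi] by rewrite in_itv/= ltW.
  by rewrite -cos_norm leNgt (ltr_cos It Ieta) -leNgt ge_min tge.
apply: (@le_trans _ _ (B + B)).
  rewrite -{2}[f]tau0; apply: le_trans (rnormD _ _) _; apply: lerD => //.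
  by have := rnormBC 0 (tau 0 f); rewrite sub0r subr0 => ->.
apply: (@le_trans _ _ ((B + B) / d * d)); first by rewrite divfK// gt_eqF.
rewrite -[leLHS]add0r; apply: lerD; first exact: ltW.
by rewrite ler_wpM2l// /d; lra.
Qed.

(** On fine grids the sum of the first N partial sums is approximated by the mean of K(t) tau_t f,
    where K is N times the Fejer kernel and has mean exactly N. Subtracting N f leaves the mean of
    K(t) (tau_t f - f). By [modulus_at_origin] this is at most N eps plus a term in which the decay
    of K cancels the weight, leaving 4 C for every N. *)
Lemma fejer (eps : R) : 0 < eps -> exists C : R, forall N : nat,
  rnorm (\sum_(k < N) symmetric_sum (fourier_coef (iota f)) e k - N%:R *: f) <=
  N%:R * eps + C.
Proof.
move=> eps0; have [C C0 HC] := modulus_at_origin eps0.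
exists (C * 4) => N.
rewrite /symmetric_sum -(sum_differences (fun k => fourier_coef (iota f) k *: e k)).
have cmode m : rsum (phi m) M 0 @[M --> \oo] --> fourier_coef (iota f) m *: e m.
  apply/cvg_rnormP => del del0; have d2 : 0 < del / 2 by rewrite divr_gt0.
  have [n Hn] := fourier_mode m d2; exists n => // M /= /Hn[_ /le_lt_trans]; apply.
  by rewrite ltr_pdivrMr// ltr_pMr// ltr1n.
have /cvg_rnormP cT : \sum_(j < N) \sum_(l < N) rsum (phi (j%:Z - l%:Z)) M 0 @[M --> \oo] -->
    \sum_(j < N) \sum_(l < N) fourier_coef (iota f) (j%:Z - l%:Z) *: e (j%:Z - l%:Z).
  apply: cvg_big => [|j _]; first exact: add_continuous.
  by apply: cvg_big => [|l _]; [exact: add_continuous|exact: cmode].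
pose K t : R := Normc.normc (dirichlet N t) ^+ 2.
have TE M : \sum_(j < N) \sum_(l < N) rsum (phi (j%:Z - l%:Z)) M 0 =
    (M%:R^-1)%:C *: \sum_(i < M) (K (grid M i))%:C *: tau (grid M i) f.
  under eq_bigr do rewrite -scaler_sumr.
  rewrite -scaler_sumr; congr (_ *: _).
  under eq_bigr do rewrite exchange_big/=.
  rewrite exchange_big/=; apply: eq_bigr => i _.
  rewrite /K -fejer_kernelE scaler_suml; apply: eq_bigr => j _.
  by rewrite scaler_suml; apply: eq_bigr => l _; rewrite /phi addr0.
have fE M : (N <= M)%N -> N%:R *: f = (M%:R^-1)%:C *: \sum_(i < M) (K (grid M i))%:C *: f.
  move=> NM; rewrite -scaler_suml scalerA -rmorph_sum -rmorphM fejer_kernel_mean//.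
  by rewrite rmorph_nat.
apply/ler_addgt0Pr => del del0.
have [M1 _ HM1] := cT _ del0.
(* At least N, for the kernel mean to be exact; a successor, to be nonzero. *)
pose M := (maxn M1 N).+1.
have {}HM1 := HM1 M (leqW (leq_maxl _ _)).
have NM : (N <= M)%N := leqW (leq_maxr _ _).
rewrite [leRHS]addrC; apply: le_trans (rnorm_dist _ _ _) _; apply: lerD (ltW HM1) _.
rewrite TE (fE _ NM) -scalerBr -sumrB.
under eq_bigr do rewrite -scalerBr.
rewrite rnormZ normc_real ?invr_ge0//.
have -> : N%:R * eps + C * 4 = M%:R^-1 * \sum_(i < M) (K (grid M i) * eps + C * 4).
  rewrite big_split/= [RHS]mulrDr -mulr_suml mulrA fejer_kernel_mean//; congr (_ + _).
  by rewrite sumr_const card_ord -[(C * 4) *+ M]mulr_natl mulKf// pnatr_eq0.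
rewrite ler_wpM2l ?invr_ge0//; apply: le_trans (rnorm_sum _) (ler_sum _ _) => i _.
have K0 : 0 <= K (grid M i) by exact: sqr_ge0.
rewrite rnormZ normc_real//; apply: le_trans (ler_wpM2l K0 (HC _)) _.
rewrite mulrDr lerD2l mulrCA ler_wpM2l//; exact: fejer_kernel_decay.
Qed.

End homogeneous_space.

(** * From Cesaro convergence to convergence *)

Section tauberian.
Context {R : realType} {V : normedModType R[i]}.
Variables (S : nat -> V) (f : V).

(** Average S over the block of length m = floor(n / q) starting at n: by slow variation the average
    stays close to S n, and its distance to f is governed by the Cesaro errors at n and n + m, which
    are small compared with n and hence with m. *)
Lemma tauberian :
  (forall eps : R, 0 < eps -> exists C : R, forall N : nat,
    rnorm (\sum_(k < N) S k - N%:R *: f) <= N%:R * eps + C) ->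
  (forall eps : R, 0 < eps -> exists q n0 : nat, (0 < q)%N /\ forall n j : nat,
    (n0 <= n)%N -> (j * q <= n)%N -> rnorm (S (n + j)%N - S n) <= eps) ->
  S n @[n --> \oo] --> f.
Proof.
move=> cesaro slow; apply/cvg_rnormP => eps eps0.
have e4 : 0 < eps / 4 by rewrite divr_gt0.
have [q [n0 [q0 Hq]]] := slow _ e4.
(* The two Cesaro errors carry the weight (n + m) + n, at most (4 q + 1) m because n <= 2 q m. *)
pose eps' := eps / 4 / (4 * q%:R + 1).
have q1 : 0 < 4 * q%:R + 1 :> R by rewrite ltr_wpDl ?mulr_ge0.
have [|C HC] := cesaro eps'; first by rewrite divr_gt0.
have HC' N : rnorm (\sum_(k < N) S k - N%:R *: f) <= N%:R * eps' + `|C|.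
  by apply: le_trans (HC N) _; rewrite lerD2l ler_norm.
(* From m >= K on, the two additive constants of the Cesaro bounds together cost at most m eps /
   4. *)
pose K := (Num.Def.archi_bound (`|C| *+ 2 / (eps / 4))).+1.
exists (maxn n0 (K * q)) => // n /=; rewrite geq_max => /andP[n0n Kqn].
pose m := (n %/ q)%N.
have Km : (K <= m)%N by rewrite leq_divRL.
have m0 : 0 < m%:R :> R by rewrite ltr0n (leq_trans _ Km).
have Cm : `|C| *+ 2 <= m%:R * (eps / 4).
  rewrite -ler_pdivrMr//; apply/ltW; apply: lt_le_trans (archi_boundP _) _.
    by apply: divr_ge0; [exact: mulrn_wge0|exact: ltW].
  by rewrite ler_nat ltnW.
have nm : n%:R <= 2 * q%:R * m%:R :> R.
  rewrite -!natrM ler_nat; have := ltn_ceil n q0; rewrite -/m => h.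
  have : (0 < m)%N by rewrite -(ltr0n R).
  by move=> m1; apply: leq_trans (ltnW h) _; rewrite mulSn; nia.
have mq : (m * q <= n)%N by exact: leq_trunc_div.
(* The sum of S over the block is the difference of two Cesaro sums. *)
have E : m%:R *: (S n - f) = \sum_(j < m) (S n - S (n + j)%N) +
    ((\sum_(k < n + m) S k - (n + m)%:R *: f) - (\sum_(k < n) S k - n%:R *: f)).
  rewrite big_split_ord/= sumrB sumr_const card_ord natrD scalerDl.
  have gen (a b u v w : V) : u - w = (u - b) + ((a + b - (v + w)) - (a - v)).
    by rewrite opprD (addrACA a) [_ + (b - w)]addrC addrK subrKA.
  by rewrite scalerBr scaler_nat; exact: gen.
rewrite rnormBC -(ltr_pM2l m0).
have -> : m%:R * rnorm (S n - f) = rnorm (m%:R *: (S n - f)).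
  by rewrite rnormZ -(rmorph_nat (real_complex R)) normc_real.
rewrite E; apply: le_lt_trans (rnormD _ _) _.
have h1 : rnorm (\sum_(j < m) (S n - S (n + j)%N)) <= m%:R * (eps / 4).
  apply: le_trans (rnorm_sum _) _.
  apply: (@le_trans _ _ (\sum_(j < m) eps / 4)).
    apply: ler_sum => j _; rewrite rnormBC; apply: Hq => //.
    by apply: leq_trans mq; rewrite leq_mul2r ltnW ?orbT.
  by rewrite sumr_const card_ord mulr_natl.
have h2 := HC' (n + m)%N; have h3 := HC' n.
have h4 := rnorm_dist (\sum_(k < n + m) S k - (n + m)%:R *: f) 0 (\sum_(k < n) S k - n%:R *: f).
rewrite subr0 (rnormBC 0) subr0 in h4.
have h5 : (n + m)%:R * eps' + n%:R * eps' <= m%:R * (eps / 4).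
  have -> : eps / 4 = eps' * (4 * q%:R + 1) by rewrite /eps' divfK// gt_eqF.
  rewrite -mulrDl mulrA mulrAC ler_wpM2r//; first by rewrite !divr_ge0 ?ltW.
  have -> := natrD R n m; move: nm; lra.
have h6 : 0 < m%:R * (eps / 4) by rewrite mulr_gt0.
have -> : m%:R * eps = m%:R * (eps / 4) *+ 4 by field.
apply: (@le_lt_trans _ _ (m%:R * (eps / 4) *+ 3)); last first.
  by rewrite [ltRHS]mulrSr ltrDl.
rewrite mulrSr [leRHS]addrC; apply: lerD => //; apply: le_trans h4 _.
apply: le_trans (lerD h2 h3) _; rewrite addrACA mulr2n; exact: lerD.
Qed.

End tauberian.

(** * Smallness of short blocks of coefficients *)

Section estimates.
Context {R : realType}.

(** An unordered sum is the supremum of its finite partial sums, and the symmetric block is one of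
    them. *)
Lemma esum_int_sum_le (a : int -> R) (n : nat) (B : R) :
  (\esum_(k in [set k : int | (n < `|k|)%N]) (a k)%:E <= B%:E)%E ->
  forall j, \sum_(i < j) (a (n + i).+1%:Z + a (- (n + i).+1%:Z)) <= B.
Proof.
move=> aB j.
pose s := [seq (n + i).+1%:Z | i <- iota 0 j] ++ [seq - (n + i).+1%:Z | i <- iota 0 j].
have us : uniq s.
  rewrite cat_uniq !map_inj_uniq ?iota_uniq//=; last 2 first.
  - by move=> x y; lia.
  - by move=> x y; lia.
  by rewrite andbT; apply/hasPn => _ /mapP[x _ ->]; apply/negP => /mapP[y _]; lia.
rewrite -lee_fin; apply: le_trans aB; apply: esum_ge; exists [set` s].
  split; first exact: finite_seq.
  move=> k /=; rewrite mem_cat => /orP[] /mapP[x _ ->]; lia.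
rewrite -fsbig_seq// big_cat/= !big_map.
have -> : iota 0 j = index_iota 0 j by rewrite /index_iota subn0.
by rewrite !big_mkord !sumEFin -EFinD -big_split.
Qed.

(* Summed over a block with [l] proportional to [1 / n], this replaces Hoelder's
   inequality. *)
Lemma ler_powR_threshold (p x l : R) : 1 <= p -> 0 <= x -> 0 < l ->
  x <= l + (l `^ (p - 1))^-1 * x `^ p.
Proof.
move=> p1 x0 l0; have lp : 0 < l `^ (p - 1) by exact: powR_gt0.
have [xl|lx] := leP x l.
  by apply: le_trans xl _; rewrite lerDl mulr_ge0 ?invr_ge0 ?powR_ge0// ltW.
rewrite -[leLHS]add0r lerD ?(ltW l0)//.
rewrite ler_pdivlMl//.
have xpos : 0 < x := lt_trans l0 lx.
have -> : p = (p - 1) + 1 by rewrite subrK.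
rewrite addrK [x `^ _]powRD ?(gt_eqF xpos) ?implybT// powRr1//.
by rewrite ler_wpM2r// ge0_ler_powR ?subr_ge0 ?nnegrE// ltW.
Qed.

(** A block beyond [n0] is the gap between two partial sums, both within [eps] of their supremum.
    This serves the case p = 1. *)
Lemma bounded_tail (y : nat -> R) (B eps : R) : (forall i, 0 <= y i) ->
  (forall j, \sum_(i < j) y i <= B) -> 0 < eps ->
  exists n0, forall n j, (n0 <= n)%N -> \sum_(i < j) y (n + i)%N <= eps.
Proof.
move=> y0 yB eps0; pose s j := \sum_(i < j) y i.
have ub : has_sup (range s).
  by split; [exists (s 0%N), 0%N|exists B => _ [j _ <-]; exact: yB].
have [_ [n0 _ <-] Hn0] := sup_adherent eps0 ub.
exists n0 => n j n0n.
have : s (n + j)%N <= sup (range s) by apply: ub_le_sup; [case: ub|exists (n + j)%N].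
rewrite {1}/s big_split_ord/= -/(s n) => h.
have : s n0 <= s n.
  by rewrite /s -(subnKC n0n) big_split_ord/= lerDl sumr_ge0.
move: Hn0 h; lra.
Qed.

End estimates.

Section block_sums.
Context {R : realType}.

(** For p > 1, the threshold inequality with l = th / n bounds a block by 2 j l plus l^(1 - p) times
    its sum of p-th powers. The powers of n cancel in the second term, leaving at most |B| / A with
    A = th^(p - 1). A is taken large first, then q large relative to th. *)
Lemma small_block_sums (x : int -> R) (p B : R) (N : nat) :
  1 <= p -> (forall k, 0 <= x k) ->
  (forall n, (N <= n)%N -> forall j,
    \sum_(i < j) (x (n + i).+1%:Z `^ p + x (- (n + i).+1%:Z) `^ p) <=
    B * (n%:R `^ (p - 1))^-1) ->
  forall eps : R, 0 < eps -> exists q n0 : nat, (0 < q)%N /\ forall n j : nat,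
    (n0 <= n)%N -> (j * q <= n)%N ->
    \sum_(i < j) (x (n + i).+1%:Z + x (- (n + i).+1%:Z)) <= eps.
Proof.
move=> p1 x0 HB eps eps0.
move: p1; rewrite le_eqVlt => /predU1P[p1|p1].
  (* For p = 1 the threshold inequality gains nothing, as l^(p - 1) = 1; the tail of a convergent
     series is used, and q = 1 will do. *)
  pose y i := x (N + i).+1%:Z + x (- (N + i).+1%:Z).
  have [|j|n0 Hn0] := @bounded_tail R y B eps _ _ eps0.
  - by move=> i; exact: addr_ge0.
  - have := HB N (leqnn N) j; rewrite -p1 subrr powRr0 invr1 mulr1.
    by under eq_bigr do rewrite !powRr1//.
  exists 1%N, (N + n0)%N; split => // n j n0n _.
  have Nn : (N <= n)%N by exact: leq_trans (leq_addr _ _) n0n.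
  have := Hn0 (n - N)%N j; rewrite leq_subRL// => /(_ n0n); rewrite /y.
  by under eq_bigr do rewrite addnA subnKC//.
(* This makes |B| / A at most eps / 2; the added 1 keeps [A] positive even if B = 0. *)
pose B' := `|B|; pose A := 2 * B' / eps + 1.
have p10 : 0 < p - 1 by rewrite subr_gt0.
have B'0 : 0 <= B' := normr_ge0 B.
have A1 : 0 <= 2 * B' / eps by apply: divr_ge0; [exact: mulr_ge0|exact: ltW].
have A0 : 0 < A by rewrite ltr_wpDl.
pose th := A `^ (p - 1)^-1.
have th0 : 0 < th by exact: powR_gt0.
have thA : th `^ (p - 1) = A by rewrite -powRrM mulVf ?gt_eqF// powRr1// ltW.
(* For j <= n / q, 2 j l = 2 j th / n is at most 2 th / q, hence at most eps / 2. *)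
pose q := (Num.Def.archi_bound (4 * th / eps)).+1.
have qth : 4 * th <= eps * q%:R.
  rewrite [leRHS]mulrC -ler_pdivrMr//; apply/ltW.
  apply: lt_le_trans (archi_boundP _) _; last by rewrite ler_nat ltnW.
  by apply: divr_ge0; [rewrite mulr_ge0// ltW|exact: ltW].
exists q, (maxn N 1); split => // n j; rewrite geq_max => /andP[Nn n1] jq.
have n0 : 0 < n%:R :> R by rewrite ltr0n.
pose l := th / n%:R.
have l0 : 0 < l by rewrite divr_gt0.
have lp : l `^ (p - 1) = A * (n%:R `^ (p - 1))^-1.
  rewrite powRM ?invr_ge0 ?ltW// thA; congr (_ * _).
  by rewrite -(powR_inv1 (ltW n0)) -!powRrM mulN1r powRN.
have np0 : 0 < n%:R `^ (p - 1) by exact: powR_gt0.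
have := HB n Nn j; set Z := \sum_(i < j) _ => ZB.
apply: (@le_trans _ _ (j%:R * (l *+ 2) + (l `^ (p - 1))^-1 * Z)).
  rewrite /Z mulr_sumr mulr_natl -[X in _ *+ X](card_ord j) -sumr_const -big_split/=.
  apply: ler_sum => i _; rewrite mulrDr mulr2n addrACA.
  by apply: lerD; apply: ler_powR_threshold => //; exact: ltW.
have h1 : j%:R * (l *+ 2) <= eps / 2.
  have jn : j%:R * q%:R <= n%:R :> R by rewrite -natrM ler_nat.
  rewrite -(ler_pM2r n0).
  have -> : j%:R * (l *+ 2) * n%:R = j%:R * th * 2 by rewrite /l; field; rewrite gt_eqF.
  have j0 : 0 <= j%:R :> R by [].
  nra.
have h2 : (l `^ (p - 1))^-1 * Z <= eps / 2.
  apply: (@le_trans _ _ ((l `^ (p - 1))^-1 * (B' * (n%:R `^ (p - 1))^-1))).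
    rewrite ler_wpM2l ?invr_ge0 ?powR_ge0//; apply: le_trans ZB _.
    by rewrite ler_wpM2r ?invr_ge0 ?powR_ge0// ler_norm.
  rewrite lp invfM invrK mulrACA mulfV ?gt_eqF// mulr1 mulrC ler_pdivrMr//.
  rewrite /A mulrDr mulr1 mulrC.
  have -> : 2 * B' / eps * (eps / 2) = B' by field; rewrite gt_eqF.
  by rewrite lerDl; apply: divr_ge0 => //; exact: ltW.
by rewrite (splitr eps); exact: lerD.
Qed.

End block_sums.

(** * Convergence of the Fourier series *)

Lemma symmetric_sumS (R : realType) (V : lmodType R[i]) (a : int -> R[i]) (e : int -> V) n :
  symmetric_sum a e n.+1 = symmetric_sum a e n +
    (a n.+1%:Z *: e n.+1%:Z + a (- n.+1%:Z) *: e (- n.+1%:Z)).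
Proof.
rewrite /symmetric_sum doubleS big_ord_recr big_ord_recl/=.
rewrite [in RHS]addrA [in RHS]addrC [in RHS]addrA; congr (_ + _ + _).
- by congr (a _ *: e _); lia.
- by apply: eq_bigr => i _; congr (a _ *: e _); rewrite /bump/=; lia.
- by congr (a _ *: e _); lia.
Qed.

(* The linear subspace X of L^1(T) is given as a complex Banach space with an
   injective linear map iota into L^1(T). Its stability under translations and
   its containing the exponentials are witnessed by tau and e, which the
   equations htau and he determine uniquely since iota is injective. *)
Theorem theorem4p1 (R : realType) (X : completeNormedModType R[i])
  (iota : {linear X -> L1T R}) (iota_inj : injective iota)
  (tau : R -> X -> X)
  (htau : forall (a : R) (f : X), iota (tau a f) = translate a (iota f))
  (e : int -> X) (he : forall k : int, iota (e k) = expL1 R k)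
  (alpha : R) (alpha_ge0 : 0 <= alpha)
  (H1 : exists c : R, 0 < c /\
    forall f : X, (normL1 (iota f))%:C <= c%:C * `|f|)
  (H2 : forall f : X, tau a f - f @[a --> (0 : R)] --> (0 : X))
  (H3 : exists M : R, exists K : nat, forall k : int, (K <= `|k|)%N ->
    `|e k| <= (M * (`|k|%N%:R `^ alpha))%:C)
  (p : R) (p_ge1 : 1 <= p) (f : X)
  (Hf : exists M : R, exists N : nat, forall n : nat, (N <= n)%N ->
    (\esum_(k in [set k : int | (n.+1 <= `|k|)%N])
       ((`|k|%N%:R `^ (alpha * p)) *
        (Normc.normc (fourier_coef (iota f) k) `^ p))%:E
     <= (M * (n%:R `^ (p - 1))^-1)%:E)%E) :
  symmetric_sum (fourier_coef (iota f)) e n @[n --> \oo] --> f.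
Proof.
have [c [c0 {}H1]] := H1; have [M [K {}H3]] := H3; have [B [N HB]] := Hf.
apply: tauberian; first exact: (fejer iota_inj htau he c0 H1 H2).
pose a := fourier_coef (iota f).
pose x (k : int) : R := `|k|%N%:R `^ alpha * Normc.normc (a k).
have x0 k : 0 <= x k by rewrite mulr_ge0 ?powR_ge0 ?normc_ge0.
have HB' n : (N <= n)%N -> forall j,
    \sum_(i < j) (x (n + i).+1%:Z `^ p + x (- (n + i).+1%:Z) `^ p) <=
    B * (n%:R `^ (p - 1))^-1.
  move=> Nn; apply: (@esum_int_sum_le _ (fun k => x k `^ p)).
  apply: le_trans (HB n Nn); apply: le_esum => k _.
  by rewrite /x powRM ?powR_ge0 ?normc_ge0// powRrM.
(* The constant of (3) carries no sign, hence the absolute value. *)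
have ek k : (K <= `|k|)%N -> rnorm (a k *: e k) <= `|M| * x k.
  move=> /H3; rewrite rnormE lecR => ekM.
  rewrite rnormZ /x mulrA mulrC ler_wpM2r ?normc_ge0//.
  by apply: le_trans ekM _; rewrite ler_wpM2r ?powR_ge0// ler_norm.
move=> eps eps0.
(* [eps] will be divided by |M| + 1, which is nonzero even if M = 0. *)
have M1 : 0 < `|M| + 1 by rewrite ltr_wpDl.
have eps1 : 0 < eps / (`|M| + 1) by rewrite divr_gt0.
have [q [n0 [q0 Hq]]] := small_block_sums p_ge1 x0 HB' eps1.
(* Beyond [K] every frequency of the block satisfies the bound in (3). *)
exists q, (maxn n0 K); split => // n j; rewrite geq_max => /andP[n0n Kn] jq.
have -> : symmetric_sum a e (n + j)%N - symmetric_sum a e n =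
    \sum_(i < j) (a (n + i).+1%:Z *: e (n + i).+1%:Z +
                  a (- (n + i).+1%:Z) *: e (- (n + i).+1%:Z)).
  elim: j {jq} => [|j IH]; first by rewrite addn0 big_ord0 subrr.
  by rewrite addnS symmetric_sumS big_ord_recr/= -IH addrAC.
apply: le_trans (rnorm_sum _) _.
apply: (@le_trans _ _ (\sum_(i < j) (`|M| + 1) * (x (n + i).+1%:Z + x (- (n + i).+1%:Z)))).
  apply: ler_sum => i _; apply: le_trans (rnormD _ _) _; rewrite mulrDr.
  by apply: lerD; (apply: le_trans (ek _ _) _; first by [lia | rewrite abszN; lia]);
    rewrite ler_wpM2r// lerDl.
by rewrite -mulr_sumr mulrC -ler_pdivlMr//; exact: Hq.
Qed.
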